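(* Consider a sequence, indexed by $N$, of completely randomized non-uniform designs (with $\overline n,\underline c,\overline c$ fixed), a grouping of $\mathcal Q_{\mathrm U}$, and the composite estimator $\hat V_{\hat\gamma}=F^\top\hat V_{\hat Y}F$ where $\hat V_{\hat Y}$ is diagonal with $\hat V_{\hat Y}(q,q)=\mu_{\langle g\rangle_q}(Y_q-\hat Y_{\langle g\rangle_q})^2$ for $q\in\mathcal Q_{\mathrm U}$ and $\hat V_{\hat Y}(q,q)=N_q^{-1}\hat S(q,q)$ for $q\in\mathcal Q_{\mathrm R}\cup\mathcal Q_{\mathrm L}$. Assume $S(q,q)>0$ for all $q$, Conditions 3, 5 and 6, and that $\max_g\mu_{\langle g\rangle}$, $\Delta$ and $\zeta$ are bounded by constants. Write $F_{\mathrm U},F_{\mathrm R},F_{\mathrm L}$ for the submatrices of rows of $F$ indexed by $\mathcal Q_{\mathrm U},\mathcal Q_{\mathrm R},\mathcal Q_{\mathrm L}$. Then (i) $\mathbb E\{\hat V_{\hat\gamma}\}\succeq V_{\hat\gamma}$; (ii) $\|\hat V_{\hat\gamma}-\mathbb E\hat V_{\hat\gamma}\|_\infty^2=O_{\mathbb P}\big(\|F_{\mathrm U}\|_\infty^4|\mathcal Q_{\mathrm U}|H^2+\|F_{\mathrm R}\|_\infty^4|\mathcal Q_{\mathrm R}|H^2+\|F_{\mathrm L}\|_\infty^4|\mathcal Q_{\mathrm L}|^4N_{\mathrm L}^{-3}H^2\big)$; (iii) $\|\hat V_{\hat\gamma}-\mathbb E\hat V_{\hat\gamma}\|_{\mathrm{op}}^2=O_{\mathbb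 P}\big(\|F_{\mathrm U}\|_\infty^4|\mathcal Q_{\mathrm U}|H^4+\|F_{\mathrm R}\|_\infty^4|\mathcal Q_{\mathrm R}|H^4+\|F_{\mathrm L}\|_\infty^4|\mathcal Q_{\mathrm L}|^4N_{\mathrm L}^{-3}H^4\big)$ (with the convention $0\cdot\infty=0$ when some of these sets are empty).
   Context: Randomization model: $N$ units, $Q$ treatment levels, group sizes $N_1,\dots,N_Q\ge1$ with $\sum_qN_q=N$; unit $i$ has fixed real potential outcomes $Y_i(q)$. Under complete randomization $Z$ is uniform over all vectors in $[Q]^N$ with exactly $N_q$ coordinates equal to $q$; $Y_i=Y_i(Z_i)$. $\overline Y(q)=N^{-1}\sum_iY_i(q)$, $S(q,q')=(N-1)^{-1}\sum_i(Y_i(q)-\overline Y(q))(Y_i(q')-\overline Y(q'))$, $S=(S(q,q'))$, $S^\star(q,q')=S(q,q')/\sqrt{S(q,q)S(q',q')}$, $V_{\hat Y}=\mathrm{diag}(N_q^{-1}S(q,q))-N^{-1}S$, $V_{\hat\gamma}=F^\top V_{\hat Y}F$ for fixed $F\in\mathbb R^{Q\times H}$; $\hat Y_q=N_q^{-1}\sum_{i:Z_i=q}Y_i$, $\hat S(q,q)=(N_q-1)^{-1}\sum_{i:Z_i=q}(Y_i-\hat Y_q)^2$ (for $N_q\ge2$). For $q$ with $N_q=1$, $Y_q$ denotes the observed outcome of the unit assigned to $q$. $\|A\|_\infty$ = max absolute entry, $\|A\|_{\mathrm{op}}$ = spectral norm. Non-uniform design: $[Q]=\mathcal Q_{\mathrm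 S}\cup\mathcal Q_{\mathrm L}$ disjoint, with $N_q=c_qN_0$, $\underline c\le c_q\le\overline c$ for $q\in\mathcal Q_{\mathrm L}$ ($N_0$ a positive integer), $N_q\le\overline n$ for $q\in\mathcal Q_{\mathrm S}$; $\mathcal Q_{\mathrm U}=\{q:N_q=1\}$, $\mathcal Q_{\mathrm R}=\{q\in\mathcal Q_{\mathrm S}:N_q\ge2\}$; $N_{\mathrm L}=\sum_{q\in\mathcal Q_{\mathrm L}}N_q$. Grouping: a fixed partition $\mathcal Q_{\mathrm U}=\bigcup_{g=1}^G\langle g\rangle$ into disjoint groups of size $\ge2$; $\langle g\rangle_q$ is the group containing $q$; $\hat Y_{\langle g\rangle}=|\langle g\rangle|^{-1}\sum_{q\in\langle g\rangle}Y_q$, $\overline Y_{\langle g\rangle}=|\langle g\rangle|^{-1}\sum_{q\in\langle g\rangle}\overline Y(q)$, $\mu_{\langle g\rangle}=(1-2N^{-1})^{-1}(1-|\langle g\rangle|^{-1})^{-2}$; $\varrho_{\langle g\rangle}$ is the largest eigenvalue of $(S^\star(q,q'))_{q,q'\in\langle g\rangle}$. Condition 3: $\max_qN^{-1}\sum_i\{Y_i(q)-\overline Y(q)\}^4\le\Delta^4$. Condition 5: $N-\varrho_{\langle g\rangle}-(|\langle g\rangle|-1)\ge0$ for all groups. Condition 6: $\max_g\max_{q\in\langle g\rangle}|\overline Y(q)-\overline Y_{\langle g\rangle}|\le\zeta$. *)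

(* Defs.v *)
From HB Require Import structures.
From mathcomp Require Import all_boot all_order all_algebra.
From mathcomp Require Import classical_sets reals.
Set Implicit Arguments. Unset Strict Implicit. Unset Printing Implicit Defensive.
Import Order.TTheory GRing.Theory Num.Theory.
Local Open Scope ring_scope.
Local Open Scope classical_set_scope.

Record design (R : realType) := Design {
  nU : nat;                          (* N : number of units *)
  nQ : nat;                          (* Q : number of treatment levels *)
  nH : nat;
  gsize : 'I_nQ -> nat;
  Ypo : 'I_nU -> 'I_nQ -> R;         (* potential outcomes Y_i(q) *)
  Fm : 'M[R]_(nQ, nH);
  inL : {set 'I_nQ};
  grp : 'I_nQ -> nat                 (* group label; groups of Q_U are the
                                        classes {q' in Q_U | grp q' = grp q} *)
}.

Section DesignDefs.
Variable R : realType.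
Variable d : design R.

Local Notation N := (nU d).
Local Notation Q := (nQ d).
Local Notation H := (nH d).
Local Notation Nq := (@gsize _ d).
Local Notation Y := (@Ypo _ d).

Definition assign := {ffun 'I_N -> 'I_Q}.

(* support of complete randomization: exactly N_q units get level q *)
Definition Omega : {set assign} :=
  [set z : assign | [forall q : 'I_Q, #|[set i | z i == q]| == Nq q]].

Definition Ex (X : assign -> R) : R :=
  (#|Omega|%:R)^-1 * \sum_(z in Omega) X z.
Definition Pr (A : pred assign) : R :=
  #|[set z in Omega | A z]|%:R / #|Omega|%:R.

Definition Ybar (q : 'I_Q) : R := (N%:R)^-1 * \sum_i Y i q.
Definition Scov (q q' : 'I_Q) : R :=
  (N%:R - 1)^-1 * \sum_i (Y i q - Ybar q) * (Y i q' - Ybar q').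
Definition Scor (q q' : 'I_Q) : R :=
  Scov q q' / Num.sqrt (Scov q q * Scov q' q').

Definition VY : 'M[R]_Q :=
  diag_mx (\row_q ((Nq q)%:R^-1 * Scov q q))
  - (N%:R)^-1 *: \matrix_(q, q') Scov q q'.
Definition Vgamma : 'M[R]_H := (Fm d)^T *m VY *m Fm d.

Definition QU : {set 'I_Q} := [set q | Nq q == 1%N].
Definition QL : {set 'I_Q} := inL d.
Definition QS : {set 'I_Q} := ~: inL d.
Definition QR : {set 'I_Q} := [set q in QS | (2 <= Nq q)%N].
Definition NL : nat := (\sum_(q in QL) Nq q)%N.

Definition group (q : 'I_Q) : {set 'I_Q} := [set q' in QU | grp q' == grp q].

Definition Ybar_grp (g : {set 'I_Q}) : R := (#|g|%:R)^-1 * \sum_(q in g) Ybar q.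
Definition mu_grp (g : {set 'I_Q}) : R :=
  (1 - 2%:R / N%:R)^-1 * ((1 - (#|g|%:R)^-1) ^+ 2)^-1.

Definition corr_sub (g : {set 'I_Q}) : 'M[R]_#|g| :=
  \matrix_(i, j) Scor (enum_val i) (enum_val j).
Definition rho_grp (g : {set 'I_Q}) : R := sup [set a : R | eigenvalue (corr_sub g) a].

Definition Yhat (z : assign) (q : 'I_Q) : R :=
  ((Nq q)%:R)^-1 * \sum_(i | z i == q) Y i q.
Definition Shat (z : assign) (q : 'I_Q) : R :=
  ((Nq q)%:R - 1)^-1 * \sum_(i | z i == q) (Y i q - Yhat z q) ^+ 2.
Definition Yhat_grp (z : assign) (g : {set 'I_Q}) : R :=
  (#|g|%:R)^-1 * \sum_(q in g) Yhat z q.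

Definition VYhat (z : assign) : 'M[R]_Q :=
  diag_mx (\row_q (if q \in QU
                   then mu_grp (group q) * (Yhat z q - Yhat_grp z (group q)) ^+ 2
                   else ((Nq q)%:R)^-1 * Shat z q)).
Definition Vgamma_hat (z : assign) : 'M[R]_H := (Fm d)^T *m VYhat z *m Fm d.
Definition EVgamma_hat : 'M[R]_H := \matrix_(h, h') Ex (fun z => Vgamma_hat z h h').

End DesignDefs.

Definition maxnorm (R : realType) m n (A : 'M[R]_(m, n)) : R :=
  \big[Num.max/0]_(i < m) \big[Num.max/0]_(j < n) `|A i j|.
(* ||F_S||_inf : max absolute entry over the rows indexed by S (0 if S empty) *)
Definition rows_maxnorm (R : realType) m n (A : 'M[R]_(m, n)) (S : {set 'I_m}) : R :=
  \big[Num.max/0]_(i in S) \big[Num.max/0]_(j < n) `|A i j|.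
Definition opnorm (R : realType) m n (A : 'M[R]_(m, n)) : R :=
  sup [set r : R | exists x : 'cV[R]_n,
        \sum_j x j 0 ^+ 2 = 1 /\ r = Num.sqrt (\sum_i (A *m x) i 0 ^+ 2)].

Definition psd (R : realType) n (A : 'M[R]_n) : Prop :=
  forall x : 'cV[R]_n, 0 <= (x^T *m A *m x) 0 0.
Definition loewner_ge (R : realType) n (A B : 'M[R]_n) : Prop := psd (A - B).

Definition bigOP (R : realType) (D : nat -> design R)
  (X : forall k, assign (D k) -> R) (r : nat -> R) : Prop :=
  forall eps : R, 0 < eps -> exists M : R, 0 < M /\ exists k0 : nat,
    forall k, (k0 <= k)%N -> Pr (fun z => M * r k < `|X k z|) <= eps.

(* the rates in (ii) (p = 2) and (iii) (p = 4) *)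
Definition rate (R : realType) (d : design R) (p : nat) : R :=
  let F := Fm d in let H := (nH d)%:R in
  rows_maxnorm F (QU d) ^+ 4 * #|QU d|%:R * H ^+ p
  + rows_maxnorm F (QR d) ^+ 4 * #|QR d|%:R * H ^+ p
  + rows_maxnorm F (QL d) ^+ 4 * #|QL d|%:R ^+ 4 / (NL d)%:R ^+ 3 * H ^+ p.
Arguments bigOP [R] D X r.

(* Main.v *)
From HB Require Import structures.
From mathcomp Require Import all_boot all_order fingroup perm all_algebra.
From mathcomp Require Import ring lra.
From mathcomp Require Import classical_sets reals.
Require Import Defs.
Set Implicit Arguments. Unset Strict Implicit. Unset Printing Implicit Defensive.
Import Order.TTheory GRing.Theory Num.Theory.
Local Open Scope ring_scope.

(** (i) The difference [E Vhat_Y - V_Y] is [S / N], which is positive semidefinite,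
    plus a diagonal matrix supported on the unreplicated levels. Its entries
    there are nonnegative: expand the variance of [Y_q - Yhat_<g>], bound the block
    of [S] on [<g> \ q] by [rho_<g>] (Rayleigh quotient) and the cross terms by
    [S(q,q) + 2 S(q,q') + S(q',q') >= 0]; Condition 5 is exactly what remains.

    (ii)-(iii) Both norms are at most the Frobenius norm, so by Markov it suffices
    to bound the variance of each entry [sum_q w_q Vhat_Y(q,q)]. Complete
    randomization is the image of a uniform permutation, and the spectral gap of
    the random transposition walk gives
      [Var f <= (4 N)^-1 sum_{i,j} E (f (Z o (i j)) - f Z)^2].
    Exchanging units [i] and [j] changes only the levels [Z_i] and [Z_j] (and
    their groups), by an amount controlled by fourth powers of the outcomes.
    This yields [O(sum_q w_q^2 N_q^-3)] for the replicated levels and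
    [O(|Q_U| max_q w_q^2)] for the unreplicated ones. A level may be both
    unreplicated and in [Q_L]; it is then counted in [Q_U]. *)

(** * Averages over a finite set *)

Section Mean.
Variables (R : realFieldType) (T : finType).
Implicit Types (A : {set T}) (X Y : T -> R).

(** For empty [A] the value is 0, because the inverse of 0 is 0. [Ex] is the instance
    [A = Omega d]. *)
Definition mean A X : R := #|A|%:R^-1 * \sum_(t in A) X t.

Lemma eq_mean A X Y : {in A, X =1 Y} -> mean A X = mean A Y.
Proof. by move=> eXY; congr (_ * _); apply: eq_bigr. Qed.

Lemma meanD A X Y : mean A (fun t => X t + Y t) = mean A X + mean A Y.
Proof. by rewrite /mean big_split mulrDr. Qed.

Lemma meanZ A c X : mean A (fun t => c * X t) = c * mean A X.
Proof. by rewrite /mean -mulr_sumr mulrCA. Qed.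

Lemma meanZr A c X : mean A (fun t => X t * c) = mean A X * c.
Proof. by rewrite /mean -mulr_suml mulrA. Qed.

Lemma meanN A X : mean A (fun t => - X t) = - mean A X.
Proof. by rewrite /mean sumrN mulrN. Qed.

Lemma meanB A X Y : mean A (fun t => X t - Y t) = mean A X - mean A Y.
Proof. by rewrite meanD meanN. Qed.

Lemma mean_sum A (I : finType) (P : pred I) (F : I -> T -> R) :
  mean A (fun t => \sum_(i | P i) F i t) = \sum_(i | P i) mean A (F i).
Proof. by rewrite /mean exchange_big mulr_sumr. Qed.

Lemma mean_cst A c : A != finset.set0 -> mean A (fun=> c) = c.
Proof.
move=> A0; rewrite /mean sumr_const -[c *+ _]mulr_natl mulrA mulVf ?mul1r //.
by rewrite pnatr_eq0 cards_eq0.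
Qed.

Lemma le_mean A X Y : {in A, forall t, X t <= Y t} -> mean A X <= mean A Y.
Proof. by move=> leXY; rewrite ler_wpM2l ?invr_ge0 ?ler0n // ler_sum. Qed.

Lemma mean_ge0 A X : {in A, forall t, 0 <= X t} -> 0 <= mean A X.
Proof. by move=> X0; rewrite mulr_ge0 ?invr_ge0 ?ler0n // sumr_ge0. Qed.

Lemma ler_norm_mean A X : `|mean A X| <= mean A (fun t => `|X t|).
Proof.
by rewrite normrM ger0_norm ?invr_ge0 ?ler0n // ler_wpM2l ?invr_ge0 ?ler0n //
  ler_norm_sum.
Qed.

Lemma mean_sqrB A X m : A != finset.set0 ->
  mean A (fun t => (X t - m) ^+ 2) =
  mean A (fun t => X t ^+ 2) - 2 * m * mean A X + m ^+ 2.
Proof.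
move=> A0; rewrite -(mean_cst (m ^+ 2) A0) -meanZ -meanB -meanD.
by apply: eq_mean => t _; ring.
Qed.

Lemma mean_variance A X : A != finset.set0 ->
  mean A (fun t => (X t - mean A X) ^+ 2) =
  mean A (fun t => X t ^+ 2) - mean A X ^+ 2.
Proof. by move=> A0; rewrite mean_sqrB //; ring. Qed.

(** Jensen's inequality for the square: the variance is nonnegative. *)
Lemma sqr_mean_le A X : mean A X ^+ 2 <= mean A (fun t => X t ^+ 2).
Proof.
have [->|A0] := eqVneq A finset.set0; first by rewrite /mean !big_set0 !mulr0 expr0n.
by rewrite -subr_ge0 -mean_variance // mean_ge0 // => t _; rewrite sqr_ge0.
Qed.

Lemma quart_mean_le A X : mean A X ^+ 4 <= mean A (fun t => X t ^+ 4).
Proof.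
rewrite (exprM (mean A X) 2 2).
rewrite (@eq_mean _ (fun t => X t ^+ 4) (fun t => (X t ^+ 2) ^+ 2)); last first.
  by move=> t _; rewrite -exprM.
apply: le_trans (sqr_mean_le _ _).
by rewrite lerXn2r ?nnegrE ?sqr_ge0 ?sqr_mean_le // mean_ge0 // => t _; rewrite sqr_ge0.
Qed.

End Mean.

Lemma mean_exchange (R : realFieldType) (S T : finType) (A : {set S}) (B : {set T})
    (F : S -> T -> R) :
  mean A (fun s => mean B (F s)) = mean B (fun t => mean A (F^~ t)).
Proof. by rewrite /mean -!mulr_sumr mulrCA; congr (_ * (_ * _)); exact: exchange_big. Qed.

(** * Uniform permutations and the gap of the transposition walk *)

Section PermMean.
Variable R : realFieldType.

Local Notation E := (mean [set: {perm _}]).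

Lemma setT_perm_neq0 n : [set: 'S_n] != finset.set0.
Proof. by apply/set0Pn; exists 1%g; rewrite inE. Qed.

Lemma lift_perm_bij n (i : 'I_n.+1) :
  bijective (fun p : 'I_n.+1 * 'S_n => lift_perm i p.1 p.2).
Proof.
apply: inj_card_bij; last by rewrite card_prod !card_Sn card_ord factS.
move=> [j s] [j' s'] /= e.
have ej : j = j' by rewrite -(lift_perm_id i j s) e lift_perm_id.
rewrite -ej in e *; congr (_, _); apply/permP => k; apply: (@lift_inj _ j).
by rewrite -!(lift_perm_lift i j) e.
Qed.

(** Conditioning on the image of [i]: given that [i] goes to [j], what remains is a uniform
    permutation of [n] points. *)
Lemma mean_perm_lift n (i : 'I_n.+1) (F : 'S_n.+1 -> R) :
  E F = n.+1%:R^-1 * \sum_j E (fun s : 'S_n => F (lift_perm i j s)).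
Proof.
rewrite /mean !cardsT !card_Sn factS natrM invfM -mulrA; congr (_ * _).
rewrite -mulr_sumr; congr (_ * _).
rewrite (reindex _ (onW_bij _ (lift_perm_bij i))) /=.
rewrite (eq_bigl predT) => [|t]; last by rewrite inE.
rewrite -(pair_bigA _ (fun j s => F (lift_perm i j s))) /=.
by apply: eq_bigr => j _; apply: eq_bigl => s; rewrite inE.
Qed.

Lemma mean_perm_val n (i : 'I_n) (g : 'I_n -> R) :
  E (fun s : 'S_n => g (s i)) = n%:R^-1 * \sum_j g j.
Proof.
case: n i g => [[]//|n] i g; rewrite (mean_perm_lift i); congr (_ * _).
apply: eq_bigr => j _; under eq_mean do rewrite lift_perm_id.
by rewrite mean_cst // setT_perm_neq0.
Qed.

Lemma sum_lift n (i : 'I_n.+1) (F : 'I_n.+1 -> R) :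
  \sum_j F j = F i + \sum_(k < n) F (lift i k).
Proof.
by rewrite (bigD1_ord i).
Qed.

(** A transposition that avoids [i] respects the conditioning on the image of [i], so the induction
    hypothesis applies to each conditioned function. *)
Lemma lift_perm_tperm n (i j : 'I_n.+1) (a b : 'I_n) (s : 'S_n) :
  (tperm (lift i a) (lift i b) * lift_perm i j s)%g =
  lift_perm i j (tperm a b * s)%g.
Proof.
apply/permP => x; rewrite permM; case: (unliftP i x) => [k|] ->.
  rewrite lift_perm_lift permM; case: (tpermP a b k) => [->|->|ka kb].
  - by rewrite tpermL lift_perm_lift.
  - by rewrite tpermR lift_perm_lift.
  - by rewrite tpermD ?lift_perm_lift // eq_sym (inj_eq lift_inj); apply/eqP.
by rewrite lift_perm_id tpermD ?lift_perm_id // eq_sym neq_lift.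
Qed.

(* The covariance of two coordinates of a uniform permutation is negative, so
   the first-order projections of [f] are almost orthogonal. *)
Lemma mean_first_order n (f : 'S_n.+2 -> R) (m := E f)
    (mu := fun i j => E (fun s => f (lift_perm i j s))) :
  n.+1%:R * (\sum_i \sum_j (mu i j - m) ^+ 2) <=
  n.+2%:R ^+ 2 * E (fun s => (f s - m) ^+ 2).
Proof.
pose phi i j := mu i j - m.
have N0 : n.+2%:R != 0 :> R by rewrite pnatr_eq0.
have n0 : n.+1%:R != 0 :> R by rewrite pnatr_eq0.
have nz k := setT_perm_neq0 k.
have phi0 i : \sum_j phi i j = 0.
  rewrite sumrB sumr_const card_ord /mu /m (mean_perm_lift i f).
  by rewrite -[(_ * _) *+ _]mulr_natl mulVKf // subrr.
(* The additive function built from the first-order effects; [f - m] is compared with a multiple of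
   it. *)
pose h (s : 'S_n.+2) := \sum_i phi i (s i).
pose K := \sum_i \sum_j (phi i j) ^+ 2.
have Efh : E (fun s => (f s - m) * h s) = n.+2%:R^-1 * K.
  under eq_mean do rewrite mulr_sumr.
  rewrite mean_sum mulr_sumr; apply: eq_bigr => i _.
  rewrite (mean_perm_lift i); congr (_ * _); apply: eq_bigr => j _.
  under eq_mean do rewrite lift_perm_id.
  by rewrite meanZr meanB mean_cst // expr2.
have Ehh : E (fun s => h s ^+ 2) <= n.+2%:R^-1 * (n.+2%:R / n.+1%:R * K).
  (* Given that [i] goes to [j], any other [k] has a uniform image off [j]; since the row [phi k]
     sums to zero, it averages to [- phi k j / n.+1]. *)
  have Eh i j : E (fun s => h (lift_perm i j s)) =
      phi i j * (n.+2%:R / n.+1%:R) - n.+1%:R^-1 * \sum_k phi k j.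
    have -> : E (fun s => h (lift_perm i j s)) =
       phi i j + \sum_(k < n.+1) n.+1%:R^-1 * - phi (lift i k) j.
      under eq_mean => s _ do rewrite /h (sum_lift i) lift_perm_id.
      rewrite meanD mean_cst //; congr (_ + _); rewrite mean_sum.
      apply: eq_bigr => k _; under eq_mean do rewrite lift_perm_lift.
      rewrite (mean_perm_val k (fun l => phi (lift i k) (lift j l))); congr (_ * _).
      by apply/eqP; rewrite -addr_eq0 addrC -(sum_lift j) phi0.
    rewrite (sum_lift i (fun k => phi k j)) -mulr_sumr sumrN.
    field.
    by rewrite addrC natr1.
  rewrite (_ : E _ = \sum_i n.+2%:R^-1 * \sum_j phi i j * E (fun s => h (lift_perm i j s))).
    rewrite -mulr_sumr ler_pM2l ?invr_gt0 ?ltr0n //.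
    rewrite exchange_big /= /K [X in _ <= _ * X]exchange_big /= mulr_sumr.
    apply: ler_sum => j _; set S := \sum_k phi k j.
    (* The column sum [S] contributes [- S ^+ 2 / n.+1], which is dropped. *)
    rewrite (eq_bigr (fun i => n.+2%:R / n.+1%:R * phi i j ^+ 2 - phi i j * (n.+1%:R^-1 * S))).
      rewrite sumrB -mulr_sumr -mulr_suml -/S lerBlDr lerDl mulrCA.
      by rewrite mulr_ge0 ?invr_ge0 ?ler0n // -expr2 sqr_ge0.
    by move=> i _; rewrite Eh -/S; ring.
  under eq_mean => s _ do rewrite expr2 {1}/h mulr_suml.
  rewrite mean_sum; apply: eq_bigr => i _; rewrite (mean_perm_lift i).
  congr (_ * _); apply: eq_bigr => j _.
  by under eq_mean do rewrite lift_perm_id; rewrite meanZ.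
(* The multiple that optimizes the resulting lower bound on the variance, given [Efh] and [Ehh]. *)
pose la : R := n.+1%:R / n.+2%:R.
have : 0 <= E (fun s => ((f s - m) - la * h s) ^+ 2).
  by apply: mean_ge0 => s _; rewrite sqr_ge0.
have -> : E (fun s => ((f s - m) - la * h s) ^+ 2) =
  E (fun s => (f s - m) ^+ 2) - 2 * la * E (fun s => (f s - m) * h s)
   + la ^+ 2 * E (fun s => h s ^+ 2).
  rewrite -!meanZ -meanB -meanD; apply: eq_mean => s _; ring.
rewrite Efh => H.
have H2 : la ^+ 2 * E (fun s => h s ^+ 2) <= la * (n.+2%:R^-1 * K).
  apply: le_trans (ler_wpM2l (sqr_ge0 _) Ehh) _.
  rewrite (_ : la ^+ 2 * _ = la * (n.+2%:R^-1 * K)) // /la; field.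
  by rewrite -(natrD _ 2) -(natrD _ 1) !pnatr_eq0.
have {H H2} : la * (n.+2%:R^-1 * K) <= E (fun s => (f s - m) ^+ 2).
  by move: H H2; move: (E (fun s => h s ^+ 2)) (n.+2%:R^-1 * K) (E _) la => x y z w; lra.
rewrite -(ler_pM2l (_ : 0 < n.+2%:R ^+ 2)); last by rewrite exprn_gt0 ?ltr0n.
apply: le_trans; rewrite (_ : _ * (_ * _) = n.+1%:R * K) // /la; field.
by rewrite -(natrD _ 2) pnatr_eq0.
Qed.

Lemma sum_S2 (f : 'S_2 -> R) (s : 'S_2) :
  \sum_t f t = f s + f (tperm ord0 ord_max * s)%g.
Proof.
set t := (_ * s)%g.
have nts : t != s.
  rewrite /t; apply/eqP => /permP /(_ ord0); rewrite permM tpermL.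
  by move/perm_inj.
rewrite (bigD1 s) //= (bigD1 t) //= big1 ?addr0 // => u /andP[us ut].
have := max_card (u |: [set s; t]).
by rewrite card_Sn cardsU1 cards2 !inE negb_or us ut (eq_sym s t) nts.
Qed.

(* Spectral gap of the random transposition walk, with the sharp constant. *)
Lemma perm_poincare n (f : 'S_n -> R) :
  n%:R * 4 * E (fun s => (f s - E f) ^+ 2) <=
  \sum_a \sum_b E (fun s => (f (tperm a b * s)%g - f s) ^+ 2).
Proof.
elim: n f => [|[|n] IH] f.
- by rewrite !mul0r big_ord0.
- rewrite (_ : E (fun s => _) = 0).
    rewrite mulr0; apply: sumr_ge0 => a _; apply: sumr_ge0 => b _.
    by apply: mean_ge0 => s _; rewrite sqr_ge0.
  rewrite /mean big1 ?mulr0 // => s _.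
  rewrite cardsT card_Sn invr1 mul1r (big_pred1 s) ?subrr ?expr0n // => t.
  rewrite !inE; apply/esym/eqP/permP => i; by rewrite !ord1.
(* Two points form a separate base case: the inductive step ends by dividing by [N * (N - 2)], which
   vanishes there. *)
case: n => [|n] in IH f *.
  have -> : E (fun s => (f s - E f) ^+ 2) =
     4^-1 * E (fun s => (f (tperm ord0 ord_max * s)%g - f s) ^+ 2).
    rewrite -meanZ; apply: eq_mean => s _.
    rewrite /mean cardsT card_Sn (eq_bigl predT) => [|t]; last by rewrite inE.
    rewrite (sum_S2 f s) (_ : 2`! = 2)%N //; by field.
  rewrite !big_ord_recl !big_ord0.
  have e (a b : 'I_2) : a = b -> E (fun s => (f (tperm a b * s)%g - f s) ^+ 2) = 0.
    move=> ->; rewrite /mean big1 ?mulr0 // => s _.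
    by rewrite tperm1 mul1g subrr expr0n.
  have el : lift ord0 ord0 = ord_max :> 'I_2 by apply/val_inj.
  rewrite el !(e ord0 ord0) // !(e ord_max ord_max) // (tpermC ord_max) !addr0 add0r.
  by move: (E _) => x; lra.
pose mu i j := E (fun s => f (lift_perm i j s)).
pose V := E (fun s => (f s - E f) ^+ 2).
pose D a b := E (fun s => (f (tperm a b * s)%g - f s) ^+ 2).
pose N : R := n.+3%:R.
have Npos : 0 < N by rewrite ltr0n.
have nz k := setT_perm_neq0 k.
have Dd a : D a a = 0.
  by rewrite /D /mean big1 ?mulr0 // => s _; rewrite tperm1 mul1g subrr expr0n.
have N1 : N - 1 = n.+2%:R by rewrite /N -[n.+3]addn1 natrD addrK.
(* Law of total variance given the image of [i]: the induction hypothesis bounds each conditional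
   variance, and the variance of the conditional means is kept. *)
have step i : (N - 1) * 4 * (N * V) <=
    N * (\sum_a \sum_b D (lift i a) (lift i b)) + (N - 1) * 4 * \sum_j (mu i j - E f) ^+ 2.
  have -> : N * V = \sum_j E (fun s => (f (lift_perm i j s) - mu i j) ^+ 2)
                     + \sum_j (mu i j - E f) ^+ 2.
    rewrite /V (mean_perm_lift i) mulVKf ?lt0r_neq0 // -big_split /=.
    by apply: eq_bigr => j _; rewrite mean_variance // mean_sqrB //; rewrite /mu; ring.
  rewrite mulrDr lerD2r mulr_sumr.
  have -> : N * (\sum_a \sum_b D (lift i a) (lift i b)) =
    \sum_j \sum_a \sum_b E (fun s => (f (lift_perm i j (tperm a b * s)%g) - f (lift_perm i j s)) ^+ 2).
    rewrite mulr_sumr exchange_big; apply: eq_bigr => a _ /=.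
    rewrite mulr_sumr exchange_big; apply: eq_bigr => b _ /=.
    rewrite /D (mean_perm_lift i) mulVKf ?lt0r_neq0 //.
    apply: eq_bigr => j _; apply: eq_mean => s _; by rewrite lift_perm_tperm.
  apply: ler_sum => j _; rewrite N1; exact: IH.
have /= first := mean_first_order f.
have {first} first : (N - 1) * (\sum_i \sum_j (mu i j - E f) ^+ 2) <= N ^+ 2 * V.
  by rewrite N1.
(* A pair of distinct points survives the removal of [i] for [N - 2] choices of [i]; diagonal pairs
   contribute nothing. *)
have sumD : \sum_i \sum_a \sum_b D (lift i a) (lift i b) = (N - 2) * \sum_a \sum_b D a b.
  have one i : \sum_a \sum_b D (lift i a) (lift i b) =
     \sum_a \sum_b D a b - \sum_b D i b - \sum_a D a i.
    rewrite [\sum_a \sum_b D a b](sum_lift i) (sum_lift i (fun a => D a i)) Dd add0r.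
    rewrite [X in _ = X - _]addrAC subrr add0r -sumrB; apply: eq_bigr => a _.
    by rewrite (sum_lift i (D (lift i a))) addrAC subrr add0r.
  rewrite (eq_bigr _ (fun i _ => one i)) !sumrB sumr_const card_ord -[_ *+ _]mulr_natl.
  rewrite -/N [\sum_i \sum_a D a i]exchange_big /=; ring.
have {step} : \sum_(i < n.+3) (N - 1) * 4 * (N * V) <=
   \sum_(i < n.+3) (N * (\sum_a \sum_b D (lift i a) (lift i b)) + (N - 1) * 4 * \sum_j (mu i j - E f) ^+ 2).
  exact: ler_sum.
rewrite sumr_const card_ord -[_ *+ _]mulr_natl -/N big_split /= -!mulr_sumr sumD.
set S := \sum_a _; set K := \sum_i _ in first * => H.
rewrite -/V -/N -/(D _ _).
(* Summed over [i], the conditional means cost at most [4 * N ^+ 2 * V] by [first]; absorbing this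
   on the left turns the factor [N - 1] into [N - 2]. *)
have H2 : N * (N - 2) * (N * 4 * V) <= N * (N - 2) * S by lra.
have : 0 < N * (N - 2).
  by rewrite mulr_gt0 // subr_gt0 /N ltr_nat.
by move=> Np; rewrite ler_pM2l in H2.
Qed.

End PermMean.

(** * Complete randomization as the image of a uniform permutation *)

Section Randomization.
Variables (R : realType) (d : design R).
Local Notation N := (nU d).
Local Notation Q := (nQ d).
Local Notation Nq := (@gsize _ d).
Implicit Types (z : assign d) (q : 'I_Q) (i j : 'I_N).

Lemma ExE (X : assign d -> R) : Ex X = mean (Omega d) X.
Proof. by []. Qed.

Definition reassign z (s : 'S_N) : assign d := [ffun i => z (s i)].

Lemma reassignM z (s t : 'S_N) : reassign (reassign z s) t = reassign z (t * s)%g.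
Proof. by apply/ffunP => i; rewrite !ffunE permM. Qed.

Lemma reassign1 z : reassign z 1%g = z.
Proof. by apply/ffunP => i; rewrite ffunE perm1. Qed.

Lemma reassign_inj (s : 'S_N) : injective (reassign^~ s).
Proof.
by apply: (can_inj (g := reassign^~ s^-1%g)) => z; rewrite reassignM mulVg reassign1.
Qed.

(* The fibers in [Omega] are classical sets; here they become boolean predicates. *)
Lemma OmegaP z : reflect (forall q, #|[pred i | z i == q]| = Nq q) (z \in Omega d).
Proof.
have e q : #|[set i | z i == q]%classic| = #|[pred i | z i == q]|.
  by apply: eq_card => i; apply/idP/idP => [/set_mem|/mem_set].
rewrite inE; apply: (iffP forallP) => zO q; first by rewrite -e (eqP (zO q)).
by rewrite e zO.
Qed.

Lemma mem_reassign z s : (reassign z s \in Omega d) = (z \in Omega d).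
Proof.
apply/OmegaP/OmegaP => zO q; rewrite -(zO q) -!sum1_card.
  rewrite (reindex_inj (@perm_inj _ s)) /=.
  by apply: eq_bigl => i; rewrite !inE ffunE.
rewrite [RHS](reindex_inj (@perm_inj _ s)) /=.
by apply: eq_bigl => i; rewrite !inE ffunE.
Qed.

Lemma Ex_reassign (s : 'S_N) (X : assign d -> R) :
  Ex (fun z => X (reassign z s)) = Ex X.
Proof.
rewrite /Ex [in RHS](reindex_inj (@reassign_inj s)).
by congr (_ * _); apply: eq_bigl => z; rewrite mem_reassign.
Qed.

Lemma sum_level z q (c : R) : z \in Omega d -> \sum_(i | z i == q) c = (Nq q)%:R * c.
Proof. by move=> /OmegaP <-; rewrite sumr_const mulr_natl. Qed.

Lemma sum_level_ind z q : z \in Omega d -> \sum_i (z i == q)%:R = (Nq q)%:R :> R.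
Proof.
move=> zO; rewrite -[RHS]mulr1 -(sum_level q 1 zO) [RHS]big_mkcond.
by apply: eq_bigr => i _; case: eqP.
Qed.

Lemma count_mem_level z q :
  count_mem q [seq z i | i <- enum 'I_N] = #|[pred i | z i == q]|.
Proof.
rewrite count_map -size_filter cardE; congr size.
by rewrite /enum_mem -filter_predI; apply: eq_filter => i /=; rewrite !inE andbT.
Qed.

(** Both assignments list each level [q] exactly [Nq q] times, so as sequences they are
    rearrangements of each other. *)
Lemma Omega_trans z0 z : z0 \in Omega d -> z \in Omega d ->
  exists s, z = reassign z0 s.
Proof.
move=> z0O zO.
have : perm_eq [tuple z i | i < N] [tuple z0 i | i < N].
  by apply/allP => q _ /=; rewrite !count_mem_level (OmegaP _ zO) (OmegaP _ z0O).
case/tuple_permP => s e; exists s; apply/ffunP => i; rewrite ffunE.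
have := congr1 (fun t => nth (z i) t i) e.
rewrite /= (nth_map i) ?size_enum_ord // nth_ord_enum.
by rewrite (nth_map i) ?size_enum_ord // nth_ord_enum tnth_mktuple.
Qed.

Lemma Omega_neq0 : (\sum_q Nq q)%N = N -> Omega d != finset.set0.
Proof.
move=> sumN; pose t := flatten [seq nseq (Nq q) q | q <- enum 'I_Q].
have size_t : size t == N.
  rewrite size_flatten /shape -map_comp sumnE big_map big_enum -[X in _ == X]sumN.
  by apply/eqP; apply: eq_bigr => q _; rewrite /= size_nseq.
apply/set0Pn; exists [ffun i => tnth (Tuple size_t) i].
apply/OmegaP => q; rewrite -count_mem_level.
rewrite (eq_map (g := tnth (Tuple size_t))) => [|i]; last by rewrite ffunE.
rewrite map_tnth_enum count_flatten sumnE -map_comp big_map big_enum (bigD1 q) //=.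
rewrite count_nseq /= eqxx mul1n big1 ?addn0 // => q' q'q.
by rewrite count_nseq /= (negbTE q'q).
Qed.

(** By transitivity the left side does not depend on [z0]. Average it over [z0], exchange the means,
    and use that each fixed permutation preserves the uniform law on [Omega d]. *)
Lemma mean_perm_reassign z0 (X : assign d -> R) : z0 \in Omega d ->
  mean [set: 'S_N] (fun s => X (reassign z0 s)) = Ex X.
Proof.
move=> z0O; have O0 : Omega d != finset.set0 by apply/set0Pn; exists z0.
set c := LHS; rewrite -(mean_cst c O0).
transitivity (mean (Omega d) (fun z => mean [set: 'S_N] (fun s => X (reassign z s)))).
  apply: eq_mean => z zO; have [t ->] := Omega_trans z0O zO.
  rewrite /c /mean; congr (_ * _); rewrite (reindex_inj (mulIg t)).
  by apply: eq_big => [s|s _]; rewrite ?inE // reassignM.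
rewrite mean_exchange -[RHS](mean_cst _ (setT_perm_neq0 N)); apply: eq_mean => s _.
exact: Ex_reassign.
Qed.

(** * Variance bound by swaps, and first and second moments *)

Section Moments.
Hypothesis sumN : (\sum_q Nq q)%N = N.
Let O0 := Omega_neq0 sumN.

Lemma Omega_poincare (f : assign d -> R) :
  N%:R * 4 * Ex (fun z => (f z - Ex f) ^+ 2) <=
  \sum_i \sum_j Ex (fun z => (f (reassign z (tperm i j)) - f z) ^+ 2).
Proof.
have /set0Pn[z0 z0O] := O0.
rewrite -(mean_perm_reassign f z0O) -(mean_perm_reassign _ z0O).
apply: le_trans (perm_poincare (fun s => f (reassign z0 s))) _.
apply: ler_sum => i _; apply: ler_sum => j _.
rewrite -(mean_perm_reassign _ z0O) le_eqVlt; apply/orP; left; apply/eqP.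
by apply: eq_mean => s _; rewrite reassignM.
Qed.

Lemma reassign_same z i j : z i = z j -> reassign z (tperm i j) = z.
Proof. by move=> e; apply/ffunP => k; rewrite ffunE; case: tpermP => [->|->|]. Qed.

(** The effect of a swap is split into a share of each of the two units. The inequality
    [(x + y)^2 <= 2 x^2 + 2 y^2] and the symmetry of the double sum produce a factor 4, which
    cancels that of [Omega_poincare]. *)
Lemma Ex_variance_swap (f : assign d -> R) (B : assign d -> 'I_N -> 'I_N -> R) :
  (forall z i j, z \in Omega d -> z i != z j ->
     `|f (reassign z (tperm i j)) - f z| <= B z i j + B z j i) ->
  N%:R * Ex (fun z => (f z - Ex f) ^+ 2) <= Ex (fun z => \sum_i \sum_j B z i j ^+ 2).
Proof.
move=> fB; rewrite -(ler_pM2l (ltr0n R 4)) mulrCA mulrA.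
apply: le_trans (Omega_poincare f) _.
pose a i j := Ex (fun z => B z i j ^+ 2).
have -> : Ex (fun z => \sum_i \sum_j B z i j ^+ 2) = \sum_i \sum_j a i j.
  by rewrite [LHS]mean_sum; apply: eq_bigr => i _; exact: mean_sum.
have sum_sym (b : 'I_N -> 'I_N -> R) :
    4 * (\sum_i \sum_j b i j) = \sum_i \sum_j (2 * b i j + 2 * b j i).
  under [RHS]eq_bigr do rewrite big_split -!mulr_sumr /=.
  rewrite big_split -!mulr_sumr /= [X in _ = _ + 2 * X]exchange_big /=.
  by rewrite -mulrDl -natrD.
rewrite {}sum_sym.
have aE i j : 2 * a i j + 2 * a j i = Ex (fun z => 2 * B z i j ^+ 2 + 2 * B z j i ^+ 2).
  by rewrite [RHS]meanD !meanZ.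
under [leRHS]eq_bigr do under eq_bigr do rewrite aE.
apply: ler_sum => i _; apply: ler_sum => j _; apply: le_mean => z zO.
have [/reassign_same ->|zij] := eqVneq (z i) (z j).
  by rewrite subrr expr0n addr_ge0 // mulr_ge0 ?ler0n ?sqr_ge0.
have {}fB := fB z i j zO zij.
rewrite -real_normK ?num_real //.
apply: (@le_trans _ _ ((B z i j + B z j i) ^+ 2)).
  by rewrite lerXn2r ?nnegrE ?(le_trans _ fB).
have := sqr_ge0 (B z i j - B z j i); lra.
Qed.

(** By exchangeability all units receive level [q] with the same probability, and these
    probabilities add up to [Nq q]. *)
Lemma Ex_sum_level q (e : 'I_N -> R) :
  Ex (fun z => \sum_(i | z i == q) e i) = (Nq q)%:R / N%:R * \sum_i e i.
Proof.
have [N0|N0] := eqVneq N 0%N.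
  have e0 (P : pred 'I_N) (F : 'I_N -> R) : \sum_(i | P i) F i = 0.
    by apply: big1 => i; have := ltn_ord i; rewrite {2}N0.
  rewrite e0 mulr0 /Ex big1 ?mulr0 // => z _; exact: e0.
have i0 : 'I_N by case: (N) N0 => // n _; exact: ord0.
pose p i := Ex (fun z => (z i == q)%:R).
have pE i j : p i = p j.
  rewrite /p -(Ex_reassign (tperm i j)); apply: eq_mean => z _.
  by rewrite ffunE tpermL.
have pv i : p i = (Nq q)%:R / N%:R.
  have : \sum_j p j = (Nq q)%:R.
    rewrite -mean_sum -[RHS](mean_cst _ O0); apply: eq_mean => z zO.
    exact: sum_level_ind.
  rewrite (eq_bigr (fun=> p i)) => [|j _]; last exact: pE.
  rewrite sumr_const card_ord -[_ *+ _]mulr_natl => <-.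
  by rewrite mulrAC mulfV ?mul1r // pnatr_eq0.
rewrite mulr_sumr (eq_bigr (fun i => Ex (fun z => (z i == q)%:R * e i))).
  rewrite -mean_sum; apply: eq_mean => z _; rewrite big_mkcond /=.
  by apply: eq_bigr => i _; case: eqP; rewrite ?mul1r ?mul0r.
by move=> i _; rewrite -(pv i) -meanZr.
Qed.

(** By exchangeability the joint probability [P2 i j] takes one value on the diagonal and one value
    [c] off it, determined by the total. Centering of [e'] reduces the off-diagonal sum to [- c]
    times the diagonal one. *)
Lemma Ex_cov_level q q' (e e' : 'I_N -> R) : (2 <= N)%N -> \sum_i e' i = 0 ->
  Ex (fun z => (\sum_(i | z i == q) e i) * (\sum_(j | z j == q') e' j)) =
  ((q == q')%:R * (Nq q)%:R - (Nq q)%:R * (Nq q')%:R / N%:R)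
    * ((N%:R - 1)^-1 * \sum_i e i * e' i).
Proof.
move=> N2 e'0.
have N0 : N%:R != 0 :> R by rewrite pnatr_eq0 -lt0n (leq_trans _ N2).
have N1 : N%:R - 1 != 0 :> R by rewrite subr_eq0 pnatr_eq1; case: (N) N2 => [|[]].
pose P2 i j := Ex (fun z => (z i == q)%:R * (z j == q')%:R).
have P2s (s : 'S_N) i j : P2 (s i) (s j) = P2 i j.
  by rewrite /P2 -[RHS](Ex_reassign s); apply: eq_mean => z _; rewrite !ffunE.
have P2d i : P2 i i = (q == q')%:R * (Nq q)%:R / N%:R.
  transitivity (Ex (fun z => (q == q')%:R * \sum_(j | z j == q) (j == i)%:R)).
    apply: eq_mean => z _; rewrite -mulr_natl.
    have [->|qq'] := eqVneq q q'; last first.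
      by case: eqP => [->|_]; rewrite ?(negbTE qq') ?mulr0 !mul0r.
    rewrite mul1r (big_mkcond (fun j => z j == q')) (bigD1 i) //= eqxx big1 ?addr0.
      by case: eqP; rewrite ?mulr1 ?mulr0.
    by move=> j /negbTE ->; case: ifP.
  rewrite [LHS]meanZ [mean _ _]Ex_sum_level (bigD1 i) //= eqxx big1 ?addr0 ?mulr1 ?mulrA //.
  by move=> j /negbTE ->.
pose c : R := ((Nq q)%:R * (Nq q')%:R - (q == q')%:R * (Nq q)%:R) / (N%:R * (N%:R - 1)).
have P2c i j : i != j -> P2 i j = c.
  move=> ij.
  have P2e i' j' : i' != j' -> P2 i' j' = P2 i j.
    (* The product of these two transpositions carries the pair [(i, j)] to [(i', j')]. *)
    move=> ij'; pose j1 := tperm i i' j.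
    rewrite -[RHS](P2s (tperm i i' * tperm j1 j')%g) !permM tpermL -/j1 tpermL tpermD //.
    by rewrite /j1 -{2}(tpermL i i') (inj_eq perm_inj) eq_sym.
    by rewrite eq_sym.
  have tot : \sum_i' \sum_j' P2 i' j' = (Nq q)%:R * (Nq q')%:R.
    rewrite -[RHS](mean_cst _ O0).
    under eq_bigr do rewrite -mean_sum.
    rewrite -mean_sum; apply: eq_mean => z zO.
    by rewrite -big_distrlr /= !sum_level_ind.
  have : \sum_i' \sum_j' P2 i' j' = N%:R * ((q == q')%:R * (Nq q)%:R / N%:R + (N%:R - 1) * P2 i j).
    rewrite (eq_bigr (fun=> (q == q')%:R * (Nq q)%:R / N%:R + (N%:R - 1) * P2 i j)).
      by rewrite sumr_const card_ord -[LHS]mulr_natl.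
    move=> i' _; rewrite (bigD1 i') //= P2d; congr (_ + _).
    rewrite (eq_bigr (fun=> P2 i j)) => [|j' ij']; last by rewrite P2e // eq_sym.
    rewrite sumr_const cardC1 card_ord -[_ *+ _]mulr_natl; congr (_ * _).
    by rewrite -subn1 natrB // (leq_trans _ N2).
  rewrite tot /c => ->; field; by rewrite N0 N1.
transitivity (\sum_i \sum_j e i * e' j * P2 i j).
  transitivity (Ex (fun z => \sum_i \sum_j e i * e' j * ((z i == q)%:R * (z j == q')%:R))).
    apply: eq_mean => z _; rewrite big_distrlr /= big_mkcond; apply: eq_bigr => i _.
    case: ifP => _; last by rewrite big1 // => j _; rewrite mul0r mulr0.
    rewrite big_mkcond; apply: eq_bigr => j _.
    by case: ifP; rewrite ?mulr1 ?mulr0.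
  rewrite [LHS]mean_sum; apply: eq_bigr => i _; rewrite mean_sum; apply: eq_bigr => j _.
  exact: meanZ.
rewrite (eq_bigr (fun i => ((q == q')%:R * (Nq q)%:R / N%:R - c) * (e i * e' i))).
  rewrite -mulr_sumr mulrA; congr (_ * _); rewrite /c; field; by rewrite N0 N1.
move=> i _; rewrite (bigD1 i) //= P2d.
rewrite (eq_bigr (fun j => e i * c * e' j)) => [|j ji]; last first.
  by rewrite P2c 1?eq_sym //; ring.
rewrite -mulr_sumr; move: e'0; rewrite (bigD1 i) //= => /eqP.
by rewrite addrC addr_eq0 => /eqP ->; ring.
Qed.

End Moments.
End Randomization.

(** * Rayleigh quotients of symmetric matrices *)

Section Rayleigh.
Variable R : realType.

Definition bform n (A : 'M[R]_n) (x y : 'rV[R]_n) : R := (x *m A *m y^T) 0 0.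

Lemma bformE n (A : 'M[R]_n) x y : bform A x y = \sum_i \sum_j x 0 i * A i j * y 0 j.
Proof.
rewrite /bform mxE exchange_big /=; apply: eq_bigr => j _.
by rewrite !mxE mulr_suml.
Qed.

Lemma bformC n (A : 'M[R]_n) x y : A^T = A -> bform A x y = bform A y x.
Proof.
move=> symA; rewrite /bform.
have -> : x *m A *m y^T = (y *m A *m x^T)^T by rewrite !trmx_mul trmxK symA mulmxA.
by rewrite mxE.
Qed.

Lemma bform_subZ n (A : 'M[R]_n) x y t : A^T = A ->
  bform A (x - t *: y) (x - t *: y) =
  bform A x x - 2 * t * bform A x y + t ^+ 2 * bform A y y.
Proof.
move=> symA; have yx := bformC y x symA.
have -> : 2 * t * bform A x y = t * bform A x y + t * bform A y x by rewrite yx; ring.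
rewrite /bform [(x - _)^T]raddfB /= [(t *: y)^T]linearZ /=.
rewrite !mulmxBl !mulmxBr -!scalemxAl -!scalemxAr !mxE; ring.
Qed.

Lemma bform1E n (x : 'rV[R]_n) : bform 1%:M x x = \sum_i x 0 i ^+ 2.
Proof.
rewrite /bform mulmx1 mxE; apply: eq_bigr => i _; by rewrite !mxE expr2.
Qed.

Lemma bform1_ge0 n (x : 'rV[R]_n) : 0 <= bform 1%:M x x.
Proof. by rewrite bform1E sumr_ge0 // => i _; rewrite sqr_ge0. Qed.

Lemma bform1_gt0 n (x : 'rV[R]_n) : x != 0 -> 0 < bform 1%:M x x.
Proof.
move=> /rV0Pn[i xi]; rewrite bform1E (bigD1 i) //= ltr_pwDl //.
  by rewrite exprn_even_gt0.
by rewrite sumr_ge0 // => j _; rewrite sqr_ge0.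
Qed.

Lemma bform_bounded n (A : 'M[R]_n) :
  exists2 K : R, 0 < K & forall x, bform A x x <= K * bform 1%:M x x.
Proof.
exists (1 + \sum_i \sum_j `|A i j|) => [|x].
  by rewrite ltr_pwDl // sumr_ge0 // => i _; rewrite sumr_ge0.
apply: (@le_trans _ _ ((\sum_i \sum_j `|A i j|) * bform 1%:M x x)); last first.
  by rewrite ler_wpM2r ?bform1_ge0 // lerDr.
rewrite bformE mulr_suml; apply: ler_sum => i _; rewrite mulr_suml; apply: ler_sum => j _.
have sq_le k : x 0 k ^+ 2 <= bform 1%:M x x.
  by rewrite bform1E (bigD1 k) //= lerDl sumr_ge0 // => l _; rewrite sqr_ge0.
rewrite mulrAC mulrC; apply: le_trans (ler_norm _) _; rewrite normrM ler_wpM2l //.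
rewrite ler_norml; have := sq_le i; have := sq_le j.
have := sqr_ge0 (x 0 i - x 0 j); have := sqr_ge0 (x 0 i + x 0 j).
by move: (bform _ _ _) => D; move=> *; apply/andP; split; nra.
Qed.

(* The least [la] with [A <= la I] makes [la I - A] positive semidefinite but
   not coercive, hence singular: [la] is an eigenvalue. *)
Lemma rayleigh_sup_eigenvalue n (A : 'M[R]_n) (x : 'rV[R]_n) : A^T = A ->
  bform A x x <= sup [set a : R | eigenvalue A a]%classic * bform 1%:M x x.
Proof.
move=> symA.
have [->|x0] := eqVneq x 0.
  by rewrite !bformE !big1 ?mulr0 // => i _; rewrite big1 // => j _; rewrite mxE !mul0r.
pose U := [set K : R | forall y, bform A y y <= K * bform 1%:M y y]%classic.
have [K0 _ UK0] := bform_bounded A.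
have lbU y : y != 0 -> lbound U (bform A y y / bform 1%:M y y).
  by move=> y0 K /(_ y); rewrite ler_pdivrMr ?bform1_gt0.
have UN0 : (U !=set0)%classic by exists K0.
have infU : has_inf U by split => //; exists (bform A x x / bform 1%:M x x); exact: lbU.
pose la := inf U.
have Ula : U la.
  move=> y; have [->|y0] := eqVneq y 0.
    by rewrite !bformE !big1 ?mulr0 // => i _; rewrite big1 // => j _; rewrite mxE !mul0r.
  by rewrite -ler_pdivrMr ?bform1_gt0 // lb_le_inf //; exact: lbU.
have eig_la : eigenvalue A la.
  rewrite /eigenvalue /eigenspace kermx_eq0 row_free_unit; apply/negP => unitB.
  pose B := A - la%:M; have [c c0 cP] := bform_bounded (- (invmx B)^T).
  suff : U (la - c^-1).
    move/(ge_inf (proj2 infU)); rewrite -/la lerBrDr gerDl leNgt.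
    by rewrite invr_gt0 c0.
  (* The form of [la I - A] is nonnegative at [y - c^-1 *: v]. Expanding there, the cross term gives
     [- 2 / c] and the term in [v] at most [1 / c] times the squared length of [y]. So [la - c^-1]
     would also be admissible, against minimality. *)
  move=> y; pose v := - (y *m invmx B).
  have vB : v *m B = - y by rewrite /v mulNmx mulmxKV.
  have symB : B^T = B by rewrite /B raddfB /= symA tr_scalar_mx.
  have yv : bform B y v = - bform 1%:M y y.
    by rewrite bformC // /bform vB mulNmx mulmx1 mxE.
  have vv : - bform B v v = bform (- (invmx B)^T) y y.
    by rewrite /bform vB /v raddfN /= trmx_mul mulNmx !mulmxN mulNmx opprK mulmxA !mxE.
  have psdB w : 0 <= - bform B w w.
    rewrite /B /bform mulmxBr mulmxBl mul_mx_scalar -scalemxAl !mxE opprB subr_ge0.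
    by have := Ula w; rewrite /bform mulmx1 !mxE.
  have := psdB (y - c^-1 *: v).
  rewrite bform_subZ //.
  rewrite yv; have := cP y; rewrite -vv.
  have -> : bform B y y = bform A y y - la * bform 1%:M y y.
    by rewrite /B /bform mulmxBr mulmxBl mul_mx_scalar -scalemxAl mulmx1 !mxE.
  move: (bform B v v) (bform A y y) (bform 1%:M y y) => bv ba D H1 H2.
  have H3 : c^-1 ^+ 2 * - bv <= c^-1 * D.
    by rewrite expr2 -mulrA ler_wpM2l ?invr_ge0 ?(ltW c0) // ler_pdivrMl.
  lra.
apply: le_trans (Ula x) _; rewrite ler_wpM2r ?bform1_ge0 //.
(* Testing [A <= la I] on an eigenvector shows that [la] bounds every eigenvalue, so the supremum is
   a genuine one. *)
apply: ub_le_sup => //; exists la => a /= /eigenvalueP[v va v0].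
have := Ula v; rewrite /bform va mulmx1 -scalemxAl mxE ler_pM2r //.
by have := bform1_gt0 v0; rewrite /bform mulmx1.
Qed.

End Rayleigh.

(** * Expectations of the variance estimators *)

Section Estimators.
Variables (R : realType) (d : design R).
Local Notation N := (nU d).
Local Notation Q := (nQ d).
Local Notation Nq := (@gsize _ d).
Local Notation Y := (@Ypo _ d).
Implicit Types (z : assign d) (q : 'I_Q) (i j : 'I_N) (g : {set 'I_Q}).

Definition dev i q : R := Y i q - Ybar q.
Definition mdev z q : R := (Nq q)%:R^-1 * \sum_(i | z i == q) dev i q.

Lemma sum_dev q : \sum_i dev i q = 0.
Proof.
have [N0|N0] := eqVneq N 0%N.
  by apply: big1 => i; have := ltn_ord i; rewrite {2}N0.
rewrite sumrB sumr_const card_ord -[_ *+ _]mulr_natl mulVKf ?subrr //.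
by rewrite pnatr_eq0.
Qed.

Lemma ScovC q q' : Scov q q' = Scov q' q.
Proof. by congr (_ * _); apply: eq_bigr => i _; rewrite mulrC. Qed.

(** [Scov] is, up to the factor [(N%:R - 1)^-1], the Gram matrix of the deviation vectors. *)
Lemma Scov_form (P : pred 'I_Q) (b : 'I_Q -> R) :
  \sum_(q | P q) \sum_(q' | P q') b q * b q' * Scov q q' =
  (N%:R - 1)^-1 * \sum_i (\sum_(q | P q) b q * dev i q) ^+ 2.
Proof.
transitivity (\sum_(q | P q) \sum_(q' | P q')
    (N%:R - 1)^-1 * \sum_i (b q * dev i q) * (b q' * dev i q')).
  apply: eq_bigr => q _; apply: eq_bigr => q' _; rewrite /Scov mulrCA mulr_sumr.
  by congr (_ * _); apply: eq_bigr => i _; rewrite -/(dev _ _) -/(dev _ _); ring.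
under eq_bigr do rewrite -mulr_sumr exchange_big /=.
rewrite -mulr_sumr; congr (_ * _); rewrite exchange_big /=.
by apply: eq_bigr => i _; rewrite expr2 big_distrlr.
Qed.

Lemma Scov_form_ge0 (P : pred 'I_Q) (b : 'I_Q -> R) : (0 < N)%N ->
  0 <= \sum_(q | P q) \sum_(q' | P q') b q * b q' * Scov q q'.
Proof.
move=> N0; rewrite Scov_form mulr_ge0 // ?invr_ge0 ?subr_ge0 ?ler1n //.
by rewrite sumr_ge0 // => i _; rewrite sqr_ge0.
Qed.

(** For [N = 1] the prefactor is the inverse of 0, which is 0; for [N = 0] the sum is empty. *)
Lemma Scov_gt0_size q : (0 < Scov q q :> R) -> (2 <= N)%N.
Proof.
move=> S0; rewrite ltnNge; apply/negP; rewrite leq_eqVlt => /orP[/eqP N1|N1].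
  have e : N%:R - 1 = 0 :> R by rewrite N1 subrr.
  by move: S0; rewrite /Scov e invr0 mul0r ltxx.
move: S0; rewrite /Scov big1 ?mulr0 ?ltxx // => i.
by have := ltn_ord i; rewrite ltnS leqn0 in N1; rewrite {2}(eqP N1).
Qed.

Section Complete.
Hypothesis sumN : (\sum_q Nq q)%N = N.
Hypothesis Nq_gt0 : forall q, (1 <= Nq q)%N.
Let O0 := Omega_neq0 sumN.

Lemma Yhat_dev z q : z \in Omega d -> Yhat z q = Ybar q + mdev z q.
Proof.
move=> zO; rewrite /mdev sumrB mulrBr sum_level // mulrA mulVf ?mul1r.
  by rewrite addrC subrK.
by rewrite pnatr_eq0 -lt0n.
Qed.

Lemma sum_sqr_Yhat z q : z \in Omega d ->
  \sum_(i | z i == q) (Y i q - Yhat z q) ^+ 2 =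
  \sum_(i | z i == q) dev i q ^+ 2 - (Nq q)%:R * mdev z q ^+ 2.
Proof.
move=> zO; rewrite -(sum_level q (mdev z q ^+ 2) zO).
have dv : \sum_(i | z i == q) dev i q = \sum_(i | z i == q) mdev z q.
  by rewrite sum_level // /mdev mulVKf // pnatr_eq0 -lt0n.
transitivity (\sum_(i | z i == q) (dev i q ^+ 2 - mdev z q ^+ 2)
   - 2 * mdev z q * (\sum_(i | z i == q) dev i q - \sum_(i | z i == q) mdev z q)).
  rewrite -sumrB mulr_sumr -sumrB; apply: eq_bigr => i _.
  by rewrite Yhat_dev // /dev; ring.
by rewrite dv subrr mulr0 subr0 sumrB.
Qed.

Lemma Ex_mdev q : Ex (fun z => mdev z q) = 0.
Proof. by rewrite [LHS]meanZ [mean _ _]Ex_sum_level // sum_dev !mulr0. Qed.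

(** The right side is the [(q, q')] entry of [VY d], which is thus the covariance matrix of the
    level means. *)
Lemma Ex_mdev2 q q' : (2 <= N)%N ->
  Ex (fun z => mdev z q * mdev z q') =
  (q == q')%:R * (Nq q)%:R^-1 * Scov q q - N%:R^-1 * Scov q q'.
Proof.
move=> N2; have nz p : (Nq p)%:R != 0 :> R by rewrite pnatr_eq0 -lt0n.
have N0 : N%:R != 0 :> R by rewrite pnatr_eq0 -lt0n (leq_trans _ N2).
transitivity (((Nq q)%:R^-1 * (Nq q')%:R^-1) *
   Ex (fun z => (\sum_(i | z i == q) dev i q) * (\sum_(j | z j == q') dev j q'))).
  by rewrite -[RHS]meanZ; apply: eq_mean => z _; rewrite /mdev; ring.
rewrite Ex_cov_level ?sum_dev //.
rewrite -[(N%:R - 1)^-1 * _]/(Scov q q').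
have [<-|] := eqVneq q q'; first by field; rewrite N0 nz.
by move=> _; rewrite !mul0r !sub0r; field; rewrite N0 !nz.
Qed.

Lemma Ex_Shat q : (2 <= Nq q)%N -> (2 <= N)%N -> Ex (fun z => Shat z q) = Scov q q.
Proof.
move=> Nq2 N2.
have N0 : N%:R != 0 :> R by rewrite pnatr_eq0 -lt0n (leq_trans _ N2).
have N1 : N%:R - 1 != 0 :> R by rewrite subr_eq0 pnatr_eq1; case: (N) N2 => [|[]].
have n0 : (Nq q)%:R != 0 :> R by rewrite pnatr_eq0 -lt0n.
have n1 : (Nq q)%:R - 1 != 0 :> R by rewrite subr_eq0 pnatr_eq1; case: (Nq q) Nq2 => [|[]].
transitivity (((Nq q)%:R - 1)^-1 * (Ex (fun z => \sum_(i | z i == q) dev i q ^+ 2)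
   - (Nq q)%:R * Ex (fun z => mdev z q * mdev z q))).
  rewrite !ExE -[in RHS]meanZ -meanB -meanZ.
  by apply: eq_mean => z zO; rewrite /Shat sum_sqr_Yhat // expr2.
rewrite Ex_sum_level // Ex_mdev2 // eqxx mul1r.
have -> : \sum_i dev i q ^+ 2 = (N%:R - 1) * Scov q q by rewrite /Scov mulVKf.
move: (Scov q q) => S; field; by rewrite N0 n0 n1.
Qed.

Lemma Ex_sqr_contrast (P : pred 'I_Q) (b : 'I_Q -> R) (c : R) : (2 <= N)%N ->
  Ex (fun z => (c + \sum_(q | P q) b q * mdev z q) ^+ 2) =
  c ^+ 2 + \sum_(q | P q) b q ^+ 2 * ((Nq q)%:R^-1 * Scov q q)
  - N%:R^-1 * \sum_(q | P q) \sum_(q' | P q') b q * b q' * Scov q q'.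
Proof.
move=> N2.
transitivity (Ex (fun z => c ^+ 2 + 2 * c * (\sum_(q | P q) b q * mdev z q)
   + \sum_(q | P q) \sum_(q' | P q') b q * b q' * (mdev z q * mdev z q'))).
  apply: eq_mean => z _; rewrite sqrrD; congr (_ + _ + _); first by ring.
  rewrite expr2 big_distrlr /=; apply: eq_bigr => q _; apply: eq_bigr => q' _; ring.
rewrite [LHS]meanD meanD mean_cst // meanZ mean_sum big1 ?mulr0 ?addr0; last first.
  by move=> q _; rewrite meanZ [mean _ _]Ex_mdev mulr0.
rewrite -addrA; congr (_ + _); rewrite mean_sum mulr_sumr -sumrB.
apply: eq_bigr => q Pq; rewrite mean_sum.
rewrite (eq_bigr (fun q' => (q == q')%:R * (b q * b q' * ((Nq q)%:R^-1 * Scov q q))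
   - N%:R^-1 * (b q * b q' * Scov q q'))); last first.
  by move=> q' _; rewrite meanZ [mean _ _]Ex_mdev2 //; ring.
rewrite sumrB -mulr_sumr; congr (_ - _).
rewrite (bigD1 q) //= eqxx mul1r big1 ?addr0 ?expr2 // => q' /andP[_].
by rewrite eq_sym => /negbTE ->; rewrite mul0r.
Qed.

End Complete.

Hypothesis Scov_gt0 : forall q, 0 < Scov q q :> R.

(** Scaling coordinate [q] by the standard deviation [sqrt (Scov q q)] turns the covariance form
    into the correlation form, to which the Rayleigh bound applies. *)
Lemma rho_grp_form g (b : 'I_Q -> R) :
  \sum_(q in g) \sum_(q' in g) b q * b q' * Scov q q' <=
  rho_grp g * \sum_(q in g) b q ^+ 2 * Scov q q.
Proof.
pose x : 'rV[R]_#|g| := \row_k (b (enum_val k) * Num.sqrt (Scov (enum_val k) (enum_val k))).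
have aux (a c u v w : R) : u != 0 -> v != 0 -> a * u * (w / (u * v)) * (c * v) = a * c * w.
  by move=> u0 v0; field; rewrite u0 v0.
have sq0 q : Num.sqrt (Scov q q) != 0 :> R by rewrite gt_eqF // sqrtr_gt0.
have sym : (corr_sub g)^T = corr_sub g.
  by apply/matrixP => k l; rewrite !mxE /Scor ScovC [X in Num.sqrt X]mulrC.
have := rayleigh_sup_eigenvalue x sym; rewrite -/(rho_grp g) bform1E bformE.
have -> : \sum_i x 0 i ^+ 2 = \sum_(q in g) b q ^+ 2 * Scov q q.
  rewrite [RHS]big_enum_val /=; apply: eq_bigr => k _.
  by rewrite mxE exprMn sqr_sqrtr // ltW.
congr (_ <= _); rewrite [RHS]big_enum_val /=; apply: eq_bigr => k _.
rewrite [RHS]big_enum_val /=; apply: eq_bigr => l _.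
rewrite !mxE /Scor (sqrtrM _ (ltW (Scov_gt0 _))).
exact: aux.
Qed.

Lemma group_refl q : q \in QU d -> q \in group q.
Proof. by move=> qU; rewrite inE qU eqxx. Qed.

(** Centered vectors with two coordinates are multiples of [(1, -1)], so Cauchy-Schwarz is an
    equality. *)
Lemma sum_zero_ord2 n (a b : 'I_n -> R) : n = 2%N -> \sum_i a i = 0 -> \sum_i b i = 0 ->
  (\sum_i a i * b i) ^+ 2 = (\sum_i a i * a i) * (\sum_i b i * b i).
Proof.
move=> n2; subst n; rewrite !big_ord_recl !big_ord0 !addr0.
move=> /eqP; rewrite addr_eq0 => /eqP -> /eqP; rewrite addr_eq0 => /eqP ->; ring.
Qed.

(* With two units the correlation matrix of a group has rank one, hence
   [rho >= 2], which Condition 5 excludes. *)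
Lemma cond5_size q : q \in QU d -> (2 <= #|group q|)%N ->
  0 <= N%:R - rho_grp (group q) - (#|group q|%:R - 1) -> (3 <= N)%N.
Proof.
move=> qU g2 c5; have N2 := Scov_gt0_size (Scov_gt0 q).
move: N2; rewrite leq_eqVlt => /orP[/eqP N2|//]; exfalso.
have qg := group_refl qU.
have [q' q'g q'q] : exists2 q', q' \in group q & q' != q.
  have : (0 < #|group q :\ q|)%N by move: g2; rewrite (cardsD1 q) qg.
  by case/card_gt0P => q' /setD1P[? ?]; exists q'.
have tt : Scov q q' ^+ 2 = Scov q q * Scov q' q'.
  rewrite /Scov exprMn (sum_zero_ord2 (esym N2) (sum_dev q) (sum_dev q')) /dev; ring.
pose t : R := Scov q q'; pose s : R := Scov q q.
(* After scaling by standard deviations this vector is proportional to [(1, 1)] or [(-1, 1)], the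
   eigenvector of eigenvalue 2 of the rank-one correlation block on [q] and [q']. *)
pose b p := if p == q then t else if p == q' then s else 0.
have bsum (F : 'I_Q -> R) : \sum_(p in group q) b p * F p = t * F q + s * F q'.
  rewrite (bigD1 q) //= (bigD1 q') ?q'g //= big1 ?addr0 => [|p /andP[/andP[_ pq] pq']].
    by rewrite /b eqxx (negbTE q'q) eqxx.
  by rewrite /b (negbTE pq) (negbTE pq') mul0r.
have := rho_grp_form (group q) b.
under eq_bigr do under eq_bigr do rewrite -mulrA.
under eq_bigr do rewrite -mulr_sumr bsum.
under [X in _ <= _ * X]eq_bigr do rewrite expr2 -mulrA.
rewrite !bsum /b eqxx (negbTE q'q) eqxx (ScovC q' q) -/t -/s => H.
have s0 : 0 < s by exact: Scov_gt0.
have t0 : 0 < t ^+ 2 by rewrite tt mulr_gt0.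
have s'E : s * Scov q' q' = t ^+ 2 by rewrite tt.
have {}H : 4 * (s * t ^+ 2) <= rho_grp (group q) * 2 * (s * t ^+ 2).
  apply: le_trans (le_trans H _); rewrite le_eqVlt; apply/orP; left; apply/eqP.
    have -> : t * (t * s + s * t) + s * (t * t + s * Scov q' q') =
      3 * (s * t ^+ 2) + s * (s * Scov q' q') by ring.
    by rewrite s'E; ring.
  have -> : t * (t * s) + s * (s * Scov q' q') = s * t ^+ 2 + s * (s * Scov q' q') by ring.
  by rewrite s'E; ring.
have {}H : 4 <= rho_grp (group q) * 2 by move: H; rewrite ler_pM2r // mulr_gt0.
have : (2 : R) <= #|group q|%:R by rewrite ler_nat.
have N2' : N%:R = 2 :> R by rewrite -N2.
move: c5 H; rewrite N2'; lra.
Qed.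

Hypothesis sumN : (\sum_q Nq q)%N = N.
Hypothesis Nq_gt0 : forall q, (1 <= Nq q)%N.

Lemma QU_size q : q \in QU d -> (Nq q)%:R = 1 :> R.
Proof. by rewrite inE => /eqP ->. Qed.

Lemma group_sub q q' : q' \in group q -> q' \in QU d.
Proof. by rewrite inE => /andP[]. Qed.

Lemma Ex_group_estimator_ge q : q \in QU d -> (2 <= #|group q|)%N ->
  0 <= N%:R - rho_grp (group q) - (#|group q|%:R - 1) ->
  Scov q q <= Ex (fun z => mu_grp (group q) * (Yhat z q - Yhat_grp z (group q)) ^+ 2).
Proof.
move=> qU g2 c5; have N3 := cond5_size qU g2 c5.
have N2 : (2 <= N)%N by exact: ltnW.
set g := group q in g2 c5 *; have qg : q \in g := group_refl qU.
pose m : R := #|g|%:R; pose b (p : 'I_Q) : R := (p == q)%:R - m^-1.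
have m2 : 2 <= m by rewrite ler_nat.
have m0 : m != 0 by rewrite gt_eqF //; lra.
have N0 : 0 < N%:R :> R by rewrite ltr0n ltnW.
have N3' : 3 <= N%:R :> R by rewrite ler_nat.
pose rest := \sum_(p in g | p != q) Scov p p : R.
pose T := \sum_(p in g | p != q) Scov q p : R.
pose W := \sum_(p in g | p != q) \sum_(p' in g | p' != q) Scov p p' : R.
pose S := Scov q q : R.
have rest0 : 0 <= rest by rewrite sumr_ge0 // => p _; rewrite ltW.
(* The Rayleigh bound is tested on the indicator of the group without [q]. *)
have Wle : W <= rho_grp g * rest.
  have := rho_grp_form g (fun p => (p != q)%:R).
  have -> : \sum_(p in g) (p != q)%:R ^+ 2 * Scov p p = rest.
    rewrite /rest big_mkcondr; apply: eq_bigr => p _; case: eqP => _ /=.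
      by rewrite expr0n mul0r.
    by rewrite expr1n mul1r.
  congr (_ <= _); rewrite /W big_mkcondr; apply: eq_bigr => p _; case: eqP => _ /=.
    by rewrite big1 // => p' _; rewrite !mul0r.
  rewrite big_mkcondr; apply: eq_bigr => p' _; case: eqP => _ /=.
    by rewrite mulr0 mul0r.
  by rewrite !mul1r.
have cross : 0 <= (m - 1) * S + 2 * T + rest.
  have -> : (m - 1) * S + 2 * T + rest =
     \sum_(p in g | p != q) (S + 2 * Scov q p + Scov p p).
    rewrite 2!big_split /= -[X in _ = _ + X + _]mulr_sumr -/T -/rest sumr_const -[S *+ _]mulr_natl.
    congr (_ * S + _ + _); have := cardsD1 q g; rewrite qg /= => gE.
    rewrite /m gE natrD addrAC subrr add0r; congr (_%:R).
    by apply: eq_card => p; rewrite in_setD1 andbC.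
  apply: sumr_ge0 => p /andP[_ pq].
  have := Scov_form_ge0 (pred2 q p) (fun=> 1) (ltnW N2).
  have pE (F : 'I_Q -> R) : \sum_(r | pred2 q p r) F r = F q + F p.
    rewrite (bigD1 q) /= ?eqxx // (bigD1 p) /= ?eqxx ?orbT ?pq // big1 ?addr0 //.
    by move=> r /andP[/andP[/orP[]->]].
  rewrite !pE !mul1r (ScovC p q) /S; lra.
have Exb : Ex (fun z => (Yhat z q - Yhat_grp z g) ^+ 2) =
  Ex (fun z => ((Ybar q - Ybar_grp g) + \sum_(p in g) b p * mdev z p) ^+ 2).
  apply: eq_mean => z zO; congr (_ ^+ 2).
  have -> : Yhat_grp z g = Ybar_grp g + mean g (mdev z).
    rewrite -[Ybar_grp g]/(mean g (@Ybar _ d)) -meanD; apply: eq_mean => p _.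
    exact: Yhat_dev.
  have -> : \sum_(p in g) b p * mdev z p = mdev z q - mean g (mdev z).
    under eq_bigr do rewrite mulrBl; rewrite sumrB -mulr_sumr; congr (_ - _).
    rewrite (bigD1 q) //= eqxx mul1r big1 ?addr0 // => p /andP[_ /negbTE ->].
    by rewrite mul0r.
  by rewrite Yhat_dev //; ring.
(* The factor in front of [S] is the reciprocal of [mu_grp g]. *)
have low : (1 - 2 / N%:R) * (1 - m^-1) ^+ 2 * S <= Ex (fun z => (Yhat z q - Yhat_grp z g) ^+ 2).
  rewrite Exb Ex_sqr_contrast //.
  have bq : b q = 1 - m^-1 by rewrite /b eqxx.
  have bp p : p != q -> b p = - m^-1 by rewrite /b => /negbTE ->; rewrite sub0r.
  have -> : \sum_(p in g) b p ^+ 2 * ((Nq p)%:R^-1 * Scov p p) =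
     (1 - m^-1) ^+ 2 * S + m^-1 ^+ 2 * rest.
    rewrite (bigD1 q) //= bq QU_size // invr1 mul1r; congr (_ + _).
    rewrite /rest mulr_sumr; apply: eq_bigr => p /andP[pg pq].
    by rewrite bp // QU_size ?(group_sub pg) // invr1 mul1r sqrrN.
  have -> : \sum_(p in g) \sum_(p' in g) b p * b p' * Scov p p' =
     (1 - m^-1) ^+ 2 * S - 2 * (1 - m^-1) * m^-1 * T + m^-1 ^+ 2 * W.
    have inner p : \sum_(p' in g) b p * b p' * Scov p p' =
       b p * ((1 - m^-1) * Scov p q - m^-1 * \sum_(p' in g | p' != q) Scov p p').
      rewrite (bigD1 q) //= bq [RHS]mulrBr [in RHS]mulrA; congr (_ + _).
      rewrite [in RHS]mulrA mulr_sumr -sumrN; apply: eq_bigr => p' /andP[_ p'q].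
      by rewrite (bp p') //; ring.
    under eq_bigr do rewrite inner.
    rewrite (bigD1 q) //= bq -/S -/T.
    rewrite (eq_bigr (fun p => - (m^-1 * (1 - m^-1)) * Scov q p
       + m^-1 ^+ 2 * \sum_(p' in g | p' != q) Scov p p')); last first.
      by move=> p /andP[_ pq]; rewrite bp // (ScovC p q); ring.
    rewrite big_split /= -[X in _ + (X + _)]mulr_sumr -[X in _ + (_ + X)]mulr_sumr -/T -/W.
    by clearbody T W S; ring.
  rewrite -subr_ge0.
  set bias := (_ - Ybar_grp g) ^+ 2.
  have b0 : 0 <= bias by rewrite sqr_ge0.
  (* The excess is regrouped into the squared bias and three nonnegative terms, which come from
     Condition 5, [Wle] and [cross] in this order. *)
  have -> : bias + ((1 - m^-1) ^+ 2 * S + m^-1 ^+ 2 * rest)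
     - N%:R^-1 * ((1 - m^-1) ^+ 2 * S - 2 * (1 - m^-1) * m^-1 * T + m^-1 ^+ 2 * W)
     - (1 - 2 / N%:R) * (1 - m^-1) ^+ 2 * S =
     bias + N%:R^-1 * m^-1 ^+ 2 *
       ((N%:R - rho_grp g - (m - 1)) * rest + (rho_grp g * rest - W)
        + (m - 1) * ((m - 1) * S + 2 * T + rest)).
    by field; rewrite m0 gt_eqF.
  apply: addr_ge0 => //; apply: mulr_ge0.
    by rewrite mulr_ge0 ?sqr_ge0 // invr_ge0 ltW.
  apply: addr_ge0; last by rewrite mulr_ge0 //; lra.
  by rewrite addr_ge0 ?subr_ge0 // mulr_ge0.
rewrite [leRHS]meanZ -[mean _ _]/(Ex _) /mu_grp -/m.
have m1 : 0 < 1 - m^-1 by rewrite subr_gt0 invf_lt1 //; lra.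
(* Here [N >= 3] matters: the correction factor in [mu_grp] must be positive. *)
have n1 : 0 < 1 - 2 / N%:R :> R by rewrite subr_gt0 ltr_pdivrMr // mul1r; lra.
rewrite -invfM ler_pdivlMl ?mulr_gt0 ?exprn_gt0 //.
Qed.

End Estimators.

(** * Part (i): the estimator is conservative *)

Lemma sandwich_diagE (R : comPzRingType) m n (F : 'M[R]_(m, n)) (r : 'rV[R]_m) h h' :
  (F^T *m diag_mx r *m F) h h' = \sum_q r 0 q * (F q h * F q h').
Proof.
rewrite mxE; apply: eq_bigr => q _; rewrite mul_mx_diag !mxE; ring.
Qed.

Section Conservative.
Variables (R : realType) (d : design R).
Local Notation N := (nU d).
Local Notation Q := (nQ d).
Local Notation Nq := (@gsize _ d).
Local Notation F := (Fm d).
Implicit Types (z : assign d) (q : 'I_Q) (i j : 'I_N).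

Definition vhat z q : R :=
  if q \in QU d then mu_grp (group q) * (Yhat z q - Yhat_grp z (group q)) ^+ 2
  else (Nq q)%:R^-1 * Shat z q.

Lemma Vgamma_hatE z h h' :
  Vgamma_hat z h h' = \sum_q vhat z q * (F q h * F q h').
Proof. by rewrite sandwich_diagE; apply: eq_bigr => q _; rewrite mxE. Qed.

Lemma EVgamma_hatE :
  EVgamma_hat d = F^T *m diag_mx (\row_q Ex (fun z => vhat z q)) *m F.
Proof.
apply/matrixP => h h'; rewrite mxE sandwich_diagE ExE.
rewrite (eq_mean (Y := fun z => \sum_q vhat z q * (F q h * F q h'))); last first.
  by move=> z _; rewrite Vgamma_hatE.
by rewrite mean_sum; apply: eq_bigr => q _; rewrite mxE meanZr.
Qed.

Hypothesis sumN : (\sum_q Nq q)%N = N.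
Hypothesis Nq_gt0 : forall q, (1 <= Nq q)%N.
Hypothesis group_ge2 : forall q, q \in QU d -> (2 <= #|group q|)%N.
Hypothesis Scov_gt0 : forall q, 0 < Scov q q :> R.
Hypothesis cond5 : forall q, q \in QU d ->
  0 <= N%:R - rho_grp (group q) - (#|group q|%:R - 1).

Lemma notin_QU q : q \notin QU d -> (2 <= Nq q)%N.
Proof. by rewrite inE; have := Nq_gt0 q; case: (gsize q) => [|[]]. Qed.

Lemma Ex_vhat_ge q : (Nq q)%:R^-1 * Scov q q <= Ex (fun z => vhat z q).
Proof.
have [qU|qU] := boolP (q \in QU d).
  rewrite ExE (eq_mean (Y := fun z => mu_grp (group q) * (Yhat z q - Yhat_grp z (group q)) ^+ 2)).
    by rewrite QU_size // invr1 mul1r; apply: Ex_group_estimator_ge; rewrite ?cond5 ?group_ge2.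
  by move=> z _; rewrite /vhat qU.
rewrite ExE (eq_mean (Y := fun z => (Nq q)%:R^-1 * Shat z q)); last first.
  by move=> z _; rewrite /vhat (negbTE qU).
rewrite meanZ -ExE Ex_Shat ?notin_QU //.
exact: (Scov_gt0_size (Scov_gt0 q)).
Qed.

Lemma EVgamma_hat_conservative : loewner_ge (EVgamma_hat d) (Vgamma d).
Proof.
move=> x; rewrite EVgamma_hatE /Vgamma -mulmxBl -mulmxBr.
pose y := F *m x.
have -> : x^T *m (F^T *m (diag_mx (\row_q Ex (vhat^~ q)) - VY d) *m F) *m x =
   y^T *m (diag_mx (\row_q Ex (vhat^~ q)) - VY d) *m y.
  by rewrite /y trmx_mul !mulmxA.
clearbody y.
rewrite /VY opprB addrCA addrC -raddfB /= mulmxDr mulmxDl mxE addr_ge0 //.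
  rewrite sandwich_diagE sumr_ge0 // => q _; rewrite !mxE mulr_ge0 //.
    by rewrite subr_ge0 Ex_vhat_ge.
  by rewrite -expr2 sqr_ge0.
have [N0|N0] := posnP N.
  by rewrite N0 invr0 scale0r mulmx0 mul0mx mxE.
rewrite -scalemxAr -scalemxAl mxE mulr_ge0 ?invr_ge0 ?ler0n //.
have := Scov_form_ge0 predT (fun q => y q 0) N0; congr (0 <= _).
rewrite mxE exchange_big /=; apply: eq_bigr => q' _; rewrite mxE mulr_suml.
by apply: eq_bigr => q _; rewrite !mxE; ring.
Qed.

End Conservative.

(** * Effect of exchanging two units *)

Section Swap.
Variables (R : realType) (d : design R).
Local Notation N := (nU d).
Local Notation Q := (nQ d).
Local Notation Nq := (@gsize _ d).
Local Notation Y := (@Ypo _ d).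
Implicit Types (z : assign d) (q : 'I_Q) (i j : 'I_N) (x y : 'I_Q -> R).

Lemma sum_level_swap z i j q (e : 'I_N -> R) :
  \sum_(k | reassign z (tperm i j) k == q) e k =
  \sum_(k | z k == q) e k + ((z i == q)%:R * (e j - e i) + (z j == q)%:R * (e i - e j)).
Proof.
have [->|ij] := eqVneq i j.
  rewrite reassign_same // !subrr !mulr0 !addr0 //.
rewrite big_mkcond (reindex_inj (@perm_inj _ (tperm i j))) /=.
under eq_bigr do rewrite ffunE tpermK.
rewrite [X in _ = X + _]big_mkcond /= (bigD1 i) // (bigD1 j) 1?eq_sym //=.
rewrite [X in _ = X + _](bigD1 i) // [X in _ = (_ + X) + _](bigD1 j) 1?eq_sym //=.
rewrite tpermL tpermR.
rewrite (eq_bigr (fun k => if z k == q then e k else 0)); last first.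
  by move=> k /andP[ki kj]; rewrite tpermD 1?eq_sym.
move: (\sum_(k | _) _) => rest.
by case: (z i == q); case: (z j == q); rewrite ?mul1r ?mul0r; ring.
Qed.

Lemma sum_pick (P : pred 'I_Q) q0 x :
  \sum_(q | P q) (q0 == q)%:R * x q = if P q0 then x q0 else 0.
Proof.
rewrite big_mkcond (bigD1 q0) //= eqxx mul1r big1 ?addr0 // => q.
by rewrite eq_sym => /negbTE ->; rewrite mul0r if_same.
Qed.

Lemma sum_by_level (P : pred 'I_Q) z (f : 'I_Q -> 'I_N -> R) :
  \sum_i (if P (z i) then f (z i) i else 0) = \sum_(q | P q) \sum_(i | z i == q) f q i.
Proof.
rewrite -big_mkcond (partition_big z P) //=; apply: eq_bigr => q Pq.
apply: eq_big => [i|i /andP[_ /eqP ->]] //.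
by have [->|] := eqVneq; rewrite ?Pq ?andbF.
Qed.

Definition gmean x q : R := mean (group q) x.

Lemma group_eq q q' : grp q = grp q' -> group q = group q'.
Proof. by move=> e; apply/setP => p; rewrite !inE e. Qed.

(** Averaging over groups has the kernel [#|group q|^-1] on pairs in a common group, which is
    symmetric. *)
Lemma gmean_adj x y :
  \sum_(q in QU d) x q * gmean y q = \sum_(q in QU d) gmean x q * y q.
Proof.
have e (u v : 'I_Q -> R) : \sum_(q in QU d) u q * gmean v q =
   \sum_(q in QU d) \sum_(q' in QU d) (if grp q' == grp q then #|group q|%:R^-1 * (u q * v q') else 0).
  apply: eq_bigr => q _; rewrite /gmean /mean mulrCA mulr_sumr mulr_sumr.
  by rewrite -big_mkcondr; apply: eq_bigl => q'; rewrite inE.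
rewrite e; under [RHS]eq_bigr do rewrite mulrC.
rewrite e exchange_big; apply: eq_bigr => q _; apply: eq_bigr => q' _.
by rewrite eq_sym; case: eqP => // /group_eq ->; rewrite [y q * _]mulrC.
Qed.

Lemma sum_gmean x : \sum_(q in QU d) gmean x q = \sum_(q in QU d) x q.
Proof.
transitivity (\sum_(q in QU d) 1 * gmean x q); first by apply: eq_bigr => q _; rewrite mul1r.
rewrite (gmean_adj (fun=> 1)); apply: eq_bigr => q qU.
by rewrite /gmean mean_cst ?mul1r //; apply/set0Pn; exists q; exact: group_refl.
Qed.

Lemma sum_gmean_quart x : \sum_(q in QU d) gmean x q ^+ 4 <= \sum_(q in QU d) x q ^+ 4.
Proof. by rewrite -(sum_gmean (fun q => x q ^+ 4)) ler_sum // => q _; exact: quart_mean_le. Qed.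

(* A perturbation of the outcomes moves the group estimators only through the
   perturbed levels: the averaging over groups is shifted to the other factor. *)
Lemma group_form_perturb (a u v : 'I_Q -> R) (kappa : R) (dl := fun q => v q - u q)
    (c := fun q => u q - gmean u q) (A := gmean (fun q => `|c q|)) :
  (forall q, q \in QU d -> `|a q| <= kappa) ->
  `|\sum_(q in QU d) a q * (v q - gmean v q) ^+ 2
    - \sum_(q in QU d) a q * (u q - gmean u q) ^+ 2| <=
  kappa * \sum_(q in QU d) ((2 * `|c q| + 2 * A q) * `|dl q| + 4 * dl q ^+ 2).
Proof.
move=> ak.
(* The termwise bound, in which group averages fall on the perturbation [dl]; after summation,
   self-adjointness of [gmean] moves them onto the centered values [c]. *)
pose G q := 2 * `|c q| * `|dl q| + 2 * `|c q| * gmean (fun p => `|dl p|) q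
   + 2 * dl q ^+ 2 + 2 * gmean (fun p => dl p ^+ 2) q.
have -> : \sum_(q in QU d) ((2 * `|c q| + 2 * A q) * `|dl q| + 4 * dl q ^+ 2) =
   \sum_(q in QU d) G q.
  rewrite /G !big_split /= -[X in _ = _ + X]mulr_sumr sum_gmean.
  have := gmean_adj (fun q => 2 * `|c q|) (fun p => `|dl p|) => ->.
  rewrite mulr_sumr -!big_split /=; apply: eq_bigr => q _.
  rewrite /gmean meanZ /A /gmean; ring.
rewrite mulr_sumr -sumrB; apply: le_trans (ler_norm_sum _ _ _) _.
apply: ler_sum => q qU; rewrite -mulrBr normrM; apply: ler_pM => //; first exact: ak.
have -> : v q - gmean v q = c q + (dl q - gmean dl q).
  have -> : gmean dl q = gmean v q - gmean u q by exact: meanB.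
  by rewrite /c /dl; ring.
rewrite -/(c q); set t := dl q - gmean dl q.
have -> : (c q + t) ^+ 2 - c q ^+ 2 = 2 * c q * t + t ^+ 2 by ring.
apply: le_trans (ler_normD _ _) _; rewrite /G -[leRHS]addrA lerD //.
  rewrite !normrM -mulrDr [`|2|]ger0_norm // ler_wpM2l ?mulr_ge0 //.
  apply: le_trans (ler_normB _ _) _; rewrite lerD2l; exact: ler_norm_mean.
rewrite ger0_norm ?sqr_ge0 //.
have : gmean dl q ^+ 2 <= gmean (fun p => dl p ^+ 2) q by exact: sqr_mean_le.
have := sqr_ge0 (dl q + gmean dl q); rewrite /t.
move: (dl q) (gmean dl q) (gmean _ q) => p r s; lra.
Qed.
End Swap.

(** * Elementary inequalities *)

Lemma sqr_sum3_le (R : realFieldType) (a b c : R) :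
  (a + b + c) ^+ 2 <= 3 * (a ^+ 2 + b ^+ 2 + c ^+ 2).
Proof.
have := sqr_ge0 (a - b); have := sqr_ge0 (b - c); have := sqr_ge0 (a - c); lra.
Qed.

Lemma quart_sum3_le (R : realFieldType) (a b c : R) :
  (a + b + c) ^+ 4 <= 27 * (a ^+ 4 + b ^+ 4 + c ^+ 4).
Proof.
rewrite !(exprM _ 2 2).
apply: (@le_trans _ _ ((3 * (a ^+ 2 + b ^+ 2 + c ^+ 2)) ^+ 2)).
  by rewrite lerXn2r ?nnegrE ?sqr_ge0 ?sqr_sum3_le // (le_trans _ (sqr_sum3_le a b c)) ?sqr_ge0.
by have := sqr_sum3_le (a ^+ 2) (b ^+ 2) (c ^+ 2); rewrite exprMn; lra.
Qed.

Lemma quart_sub_le (R : realFieldType) (a b : R) :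
  (a - b) ^+ 4 <= 8 * (a ^+ 4 + b ^+ 4).
Proof.
have h (x y : R) : (x - y) ^+ 2 <= 2 * (x ^+ 2 + y ^+ 2) by have := sqr_ge0 (x + y); lra.
rewrite !(exprM _ 2 2).
apply: (@le_trans _ _ ((2 * (a ^+ 2 + b ^+ 2)) ^+ 2)).
  by rewrite lerXn2r ?nnegrE ?sqr_ge0 ?h // (le_trans _ (h a b)) ?sqr_ge0.
have := sqr_ge0 (a ^+ 2 - b ^+ 2); lra.
Qed.

(** One deviation [x] is replaced by [y]; [s] is the sum of squared deviations and [m] their mean.
    The constant is [2 * 5]: [n * (n - 1) >= n ^+ 2 / 2], and the remaining quadratic expression is
    at most five times the sum of squares. *)
Lemma sample_variance_replace (R : realFieldType) (n s m x y : R) : 2 <= n ->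
  `|n^-1 * ((n - 1)^-1 * (s + (y ^+ 2 - x ^+ 2) - n * (m + n^-1 * (y - x)) ^+ 2))
    - n^-1 * ((n - 1)^-1 * (s - n * m ^+ 2))| <=
  10 / n ^+ 2 * (x ^+ 2 + y ^+ 2 + m ^+ 2).
Proof.
move=> n2; have n0 : 0 < n by lra. have n1 : 0 < n - 1 by lra.
have -> : n^-1 * ((n - 1)^-1 * (s + (y ^+ 2 - x ^+ 2) - n * (m + n^-1 * (y - x)) ^+ 2))
    - n^-1 * ((n - 1)^-1 * (s - n * m ^+ 2)) =
   (n * (n - 1))^-1 * (y ^+ 2 - x ^+ 2 - 2 * m * (y - x) - n^-1 * (y - x) ^+ 2).
  by field; rewrite !gt_eqF.
have K2 : (n * (n - 1))^-1 <= 2 / n ^+ 2.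
  rewrite ler_pdivlMr ?exprn_gt0 // mulrC ler_pdivrMr ?mulr_gt0 //; nra.
rewrite normrM ger0_norm ?invr_ge0 ?mulr_ge0 ?(ltW n0) ?(ltW n1) //.
rewrite (_ : 10 / n ^+ 2 * _ = 2 / n ^+ 2 * (5 * (x ^+ 2 + y ^+ 2 + m ^+ 2))); last by ring.
apply: ler_pM => //; first by rewrite invr_ge0 mulr_ge0 // ltW.
set t := n^-1 * (y - x) ^+ 2.
have t0 : 0 <= t by rewrite mulr_ge0 ?sqr_ge0 // invr_ge0 ltW.
have t1 : t <= (y - x) ^+ 2.
  by rewrite ler_piMl ?sqr_ge0 // invf_le1 //; lra.
have := sqr_ge0 (y + x); have := sqr_ge0 (m + (y - x)); have := sqr_ge0 (m - (y - x)).
have := sqr_ge0 x; have := sqr_ge0 y; have := sqr_ge0 m.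
move: t t0 t1 => t t0 t1 *; rewrite ler_norml; apply/andP; split; lra.
Qed.

(** * Variances of the replicated and unreplicated sums *)

Section Variance.
Variables (R : realType) (d : design R).
Local Notation N := (nU d).
Local Notation Q := (nQ d).
Local Notation Nq := (@gsize _ d).
Local Notation Y := (@Ypo _ d).
Implicit Types (z : assign d) (q : 'I_Q) (i j : 'I_N).

Hypothesis sumN : (\sum_q Nq q)%N = N.
Hypothesis Nq_gt0 : forall q, (1 <= Nq q)%N.
Hypothesis N_gt0 : (0 < N)%N.
Variable Delta : R.
Hypothesis cond3 : forall q, N%:R^-1 * \sum_i (Y i q - Ybar q) ^+ 4 <= Delta ^+ 4.
Let O0 := Omega_neq0 sumN.

Lemma NR_gt0 : 0 < N%:R :> R. Proof. by rewrite ltr0n. Qed.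

Lemma NqR_gt0 q : 0 < (Nq q)%:R :> R. Proof. by rewrite ltr0n. Qed.

Lemma sum_dev_quart q : \sum_i dev i q ^+ 4 <= N%:R * Delta ^+ 4.
Proof. by have := cond3 q; rewrite ler_pdivrMl ?NR_gt0. Qed.

Lemma Ex_level_quart q :
  Ex (fun z => \sum_(i | z i == q) dev i q ^+ 4) <= (Nq q)%:R * Delta ^+ 4.
Proof.
rewrite Ex_sum_level // -mulrA ler_wpM2l // ler_pdivrMl ?NR_gt0 //.
exact: sum_dev_quart.
Qed.

Lemma mdev_quart_le z q : z \in Omega d ->
  (Nq q)%:R * mdev z q ^+ 4 <= \sum_(i | z i == q) dev i q ^+ 4.
Proof.
move=> zO; have cE : #|finset (fun i => z i == q)| = Nq q.
  by rewrite cardsE; have /OmegaP := zO; apply.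
have mE (e : 'I_N -> R) :
    (Nq q)%:R^-1 * \sum_(i | z i == q) e i = mean (finset (fun i => z i == q)) e.
  by rewrite /mean cE; congr (_ * _); apply: eq_bigl => i; rewrite inE.
rewrite -ler_pdivlMl ?NqR_gt0 // /mdev !mE; exact: quart_mean_le.
Qed.

(** The two units have different levels, so at most one observation at level [q] is replaced. *)
Lemma Shat_swap z i j q : z \in Omega d -> z i != z j -> (2 <= Nq q)%N ->
  `|(Nq q)%:R^-1 * Shat (reassign z (tperm i j)) q - (Nq q)%:R^-1 * Shat z q| <=
  ((z i == q)%:R + (z j == q)%:R) *
    (10 / (Nq q)%:R ^+ 2 * (dev i q ^+ 2 + dev j q ^+ 2 + mdev z q ^+ 2)).
Proof.
move=> zO zij n2; have z'O : reassign z (tperm i j) \in Omega d by rewrite mem_reassign.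
have n2R : (2 : R) <= (Nq q)%:R by rewrite ler_nat.
rewrite /Shat !sum_sqr_Yhat // sum_level_swap.
have -> : mdev (reassign z (tperm i j)) q = mdev z q + (Nq q)%:R^-1 *
   ((z i == q)%:R * (dev j q - dev i q) + (z j == q)%:R * (dev i q - dev j q)).
  by rewrite /mdev sum_level_swap mulrDr.
have [zi|zi] := eqVneq (z i) q; have [zj|zj] := eqVneq (z j) q.
- by rewrite zi zj eqxx in zij.
- rewrite !mul1r !mul0r !addr0 mul1r; exact: sample_variance_replace.
- rewrite !mul1r !mul0r !add0r mul1r [dev i q ^+ 2 + dev j q ^+ 2]addrC.
  exact: sample_variance_replace.
- by rewrite !mul0r !addr0 mulr0 addr0 subrr normr0 mul0r.
Qed.

Section Replicated.
Variable w : 'I_Q -> R.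

Lemma replicated_variance (f := fun z => \sum_(q | q \notin QU d) w q * ((Nq q)%:R^-1 * Shat z q)) :
  Ex (fun z => (f z - Ex f) ^+ 2) <=
  900 * Delta ^+ 4 * \sum_(q | q \notin QU d) w q ^+ 2 / (Nq q)%:R ^+ 3.
Proof.
pose G z q i j := `|w q| * (10 / (Nq q)%:R ^+ 2 * (dev i q ^+ 2 + dev j q ^+ 2 + mdev z q ^+ 2)).
(* The share of [i] is the change at its own level [z i]; that of [j] is the change at [z j]. *)
pose B z i j := if z i \notin QU d then G z (z i) i j else 0.
have fB z i j : z \in Omega d -> z i != z j ->
    `|f (reassign z (tperm i j)) - f z| <= B z i j + B z j i.
  move=> zO zij; rewrite /f -sumrB; apply: le_trans (ler_norm_sum _ _ _) _.
  apply: (@le_trans _ _ (\sum_(q | q \notin QU d)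
     ((z i == q)%:R * G z q i j + (z j == q)%:R * G z q j i))).
    apply: ler_sum => q qU; rewrite -mulrBr normrM.
    rewrite (_ : _ + _ = `|w q| * (((z i == q)%:R + (z j == q)%:R) *
      (10 / (Nq q)%:R ^+ 2 * (dev i q ^+ 2 + dev j q ^+ 2 + mdev z q ^+ 2)))).
      by rewrite ler_wpM2l // Shat_swap // notin_QU.
    by rewrite /G [dev j q ^+ 2 + dev i q ^+ 2]addrC; ring.
  by rewrite big_split /= !sum_pick.
have K0 q : 0 <= w q ^+ 2 * (300 / (Nq q)%:R ^+ 4).
  by rewrite mulr_ge0 ?sqr_ge0 // divr_ge0 ?exprn_ge0.
rewrite -(ler_pM2l NR_gt0); apply: le_trans (Ex_variance_swap sumN fB) _.
(* The constant 300 is [3 * 10 ^+ 2], from squaring a sum of three terms. By Jensen the sample mean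
   costs no more than the units at level [q], hence [2 * N%:R]; taking expectations gives
   [900 = 300 * 3]. *)
apply: (@le_trans _ _ (Ex (fun z => \sum_(q | q \notin QU d)
   w q ^+ 2 * (300 / (Nq q)%:R ^+ 4) *
   (2 * N%:R * \sum_(i | z i == q) dev i q ^+ 4 + (Nq q)%:R * \sum_j dev j q ^+ 4)))).
  apply: le_mean => z zO.
  rewrite (eq_bigr (fun i => if z i \notin QU d then \sum_j G z (z i) i j ^+ 2 else 0)); last first.
    move=> i _; rewrite /B; case: ifP => // _; apply: big1 => j _; by rewrite expr0n.
  rewrite (sum_by_level (fun q => q \notin QU d) z (fun q i => \sum_j G z q i j ^+ 2)).
  apply: ler_sum => q _.
  apply: (@le_trans _ _ (\sum_(i | z i == q) \sum_j w q ^+ 2 * (300 / (Nq q)%:R ^+ 4) *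
      (dev i q ^+ 4 + dev j q ^+ 4 + mdev z q ^+ 4))).
    apply: ler_sum => i _; apply: ler_sum => j _.
    rewrite /G exprMn real_normK ?num_real // -[leRHS]mulrA ler_wpM2l ?sqr_ge0 //.
    rewrite exprMn (_ : 300 / _ = (10 / (Nq q)%:R ^+ 2) ^+ 2 * 3); last first.
      by field; rewrite gt_eqF ?NqR_gt0.
    rewrite -[leRHS]mulrA ler_wpM2l ?sqr_ge0 // !(exprM _ 2 2); exact: sqr_sum3_le.
  under eq_bigr do rewrite -mulr_sumr.
  rewrite -mulr_sumr; apply: ler_wpM2l; first exact: K0.
  under eq_bigr do rewrite 2!big_split /= !sumr_const card_ord.
  rewrite 2!big_split /= !sum_level // sumrMnl -[(\sum_(i | _) _) *+ N]mulr_natl -[mdev z q ^+ 4 *+ N]mulr_natl.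
  have := mdev_quart_le q zO; have := NR_gt0; move: (N%:R) => NN NN0 H.
  have := ler_wpM2l (ltW NN0) H; move: (Nq q)%:R (\sum_(i | _) _) (\sum_i _) (mdev z q ^+ 4).
  by move=> *; lra.
rewrite ExE mean_sum mulrA mulr_sumr.
apply: ler_sum => q _; rewrite meanZ meanD meanZ mean_cst //.
have H1 : mean (Omega d) (fun z => \sum_(i | z i == q) dev i q ^+ 4) <= (Nq q)%:R * Delta ^+ 4.
  exact: Ex_level_quart.
have H2 := sum_dev_quart q; have NN0 := NR_gt0; have n0 := NqR_gt0 q.
have -> : N%:R * (900 * Delta ^+ 4) * (w q ^+ 2 / (Nq q)%:R ^+ 3) =
   w q ^+ 2 * (300 / (Nq q)%:R ^+ 4) *
     (2 * N%:R * ((Nq q)%:R * Delta ^+ 4) + (Nq q)%:R * (N%:R * Delta ^+ 4)).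
  by field; rewrite gt_eqF.
apply: ler_wpM2l; first exact: K0.
by rewrite lerD // ler_wpM2l // ?mulr_ge0 // ltW.
Qed.

End Replicated.

Section Unreplicated.
Variables (a : 'I_Q -> R) (kappa zeta : R).
Hypothesis kappa_ge0 : 0 <= kappa.
Hypothesis a_le : forall q, q \in QU d -> `|a q| <= kappa.
Hypothesis cond6 : forall q, q \in QU d -> `|Ybar q - Ybar_grp (group q)| <= zeta.

(** The centered value is a bias bounded by [zeta], plus the error at [q], minus the group average
    of errors. By Jensen both error terms are controlled by the same sum of fourth powers, hence the
    factor 2. *)
Lemma sum_centered_quart z (c := fun q => Yhat z q - gmean (Yhat z) q) : z \in Omega d ->
  \sum_(q in QU d) c q ^+ 4 <=
  27 * \sum_(q in QU d) (zeta ^+ 4 + 2 * \sum_(i | z i == q) dev i q ^+ 4).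
Proof.
move=> zO.
apply: (@le_trans _ _ (\sum_(q in QU d)
   27 * (zeta ^+ 4 + mdev z q ^+ 4 + gmean (mdev z) q ^+ 4))).
  apply: ler_sum => q qU.
  have -> : c q = (Ybar q - Ybar_grp (group q)) + mdev z q + (- gmean (mdev z) q).
    have -> : c q = Yhat z q - (Ybar_grp (group q) + gmean (mdev z) q).
      congr (_ - _); rewrite -[Ybar_grp _]/(mean _ (@Ybar _ d)) -meanD.
      by apply: eq_mean => p _; exact: Yhat_dev.
    by rewrite Yhat_dev //; ring.
  apply: le_trans (quart_sum3_le _ _ _) _.
  have -> : (- gmean (mdev z) q) ^+ 4 = gmean (mdev z) q ^+ 4 by ring.
  rewrite ler_wpM2l // !lerD2r.
  have := cond6 qU; move: (_ - Ybar_grp _) => t tz.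
  have -> : t ^+ 4 = `|t| ^+ 4 by rewrite !(exprM _ 2 2) real_normK ?num_real.
  by rewrite lerXn2r ?nnegrE // (le_trans _ tz).
rewrite -mulr_sumr ler_wpM2l // 2!big_split /= [leRHS]big_split /= -addrA lerD2l.
have mL : \sum_(q in QU d) mdev z q ^+ 4 <=
    \sum_(q in QU d) \sum_(i | z i == q) dev i q ^+ 4.
  apply: ler_sum => q qU; apply: le_trans (mdev_quart_le q zO).
  by rewrite QU_size // mul1r.
have := sum_gmean_quart (mdev z); rewrite -mulr_sumr => gm.
by rewrite mulrDl !mul1r lerD // (le_trans gm).
Qed.

Lemma unreplicated_variance
    (f := fun z => \sum_(q in QU d) a q * (Yhat z q - Yhat_grp z (group q)) ^+ 2) :
  Ex (fun z => (f z - Ex f) ^+ 2) <=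
  kappa ^+ 2 * (162 * zeta ^+ 4 + 2052 * Delta ^+ 4) * #|QU d|%:R.
Proof.
pose c z q := Yhat z q - gmean (Yhat z) q.
pose A z := gmean (fun q => `|c z q|).
(* The perturbation bound after [2 x y <= x^2 + y^2], used twice: the coefficient 6 is
   [4 + 1 + 1]. *)
pose G z q i j := kappa * (c z q ^+ 2 + A z q ^+ 2 + 6 * (dev j q - dev i q) ^+ 2).
pose B z i j := if z i \in QU d then G z (z i) i j else 0.
pose L z q := \sum_(i | z i == q) dev i q ^+ 4.
have fB z i j : z \in Omega d -> z i != z j ->
    `|f (reassign z (tperm i j)) - f z| <= B z i j + B z j i.
  move=> zO zij; set z' := reassign _ _.
  have -> : B z i j + B z j i = \sum_(q in QU d)
     ((z i == q)%:R * G z q i j + (z j == q)%:R * G z q j i).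
    by rewrite big_split /= !sum_pick.
  apply: le_trans (group_form_perturb (Yhat z) (Yhat z') a_le) _.
  rewrite mulr_sumr; apply: ler_sum => q qU.
  have -> : Yhat z' q - Yhat z q =
     (z i == q)%:R * (dev j q - dev i q) + (z j == q)%:R * (dev i q - dev j q).
    by rewrite /Yhat QU_size // invr1 !mul1r sum_level_swap addrAC subrr add0r /dev; ring.
  rewrite -/(c z q) -/(A z q) /G.
  have key (x y t : R) : (2 * x + 2 * y) * `|t| + 4 * t ^+ 2 <= x ^+ 2 + y ^+ 2 + 6 * t ^+ 2.
    rewrite -[t ^+ 2]real_normK ?num_real //.
    by have := sqr_ge0 (x - `|t|); have := sqr_ge0 (y - `|t|); lra.
  rewrite -[c z q ^+ 2]real_normK ?num_real //.
  have [zi|_] := eqVneq (z i) q; have [zj|_] := eqVneq (z j) q.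
  - by rewrite zi zj eqxx in zij.
  - by rewrite !mul1r !mul0r !addr0 ler_wpM2l // key.
  - by rewrite !mul1r !mul0r !add0r ler_wpM2l // key.
  - by rewrite !mul0r !addr0 normr0 expr0n !mulr0 addr0 mulr0.
rewrite -(ler_pM2l NR_gt0); apply: le_trans (Ex_variance_swap sumN fB) _.
have k20 : 0 <= 3 * kappa ^+ 2 by rewrite mulr_ge0 // sqr_ge0.
(* Here [288 = 6 ^+ 2 * 8], the 8 from [quart_sub_le]; [54 = 2 * 27] since [c] and its group average
   [A] obey the same bound; and [396 = 288 + 2 * 54]. *)
apply: (@le_trans _ _ (Ex (fun z => 3 * kappa ^+ 2 * N%:R *
   \sum_(q in QU d) (54 * zeta ^+ 4 + 288 * Delta ^+ 4 + 396 * L z q)))).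
  apply: le_mean => z zO.
  rewrite (eq_bigr (fun i => if z i \in QU d then \sum_j G z (z i) i j ^+ 2 else 0)); last first.
    move=> i _; rewrite /B; case: ifP => // _; apply: big1 => j _; by rewrite expr0n.
  rewrite (sum_by_level (fun q => q \in QU d) z (fun q i => \sum_j G z q i j ^+ 2)).
  apply: (@le_trans _ _ (\sum_(q in QU d) 3 * kappa ^+ 2 *
     (N%:R * (c z q ^+ 4 + A z q ^+ 4) + 288 * (N%:R * L z q + N%:R * Delta ^+ 4)))).
    apply: ler_sum => q qU.
    apply: (@le_trans _ _ (\sum_(i | z i == q) \sum_j 3 * kappa ^+ 2 *
        (c z q ^+ 4 + A z q ^+ 4 + 288 * (dev i q ^+ 4 + dev j q ^+ 4)))).
      apply: ler_sum => i _; apply: ler_sum => j _.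
      rewrite /G exprMn -[leRHS]mulrA [leRHS]mulrCA ler_wpM2l ?sqr_ge0 //.
      apply: le_trans (sqr_sum3_le _ _ _) _; rewrite ler_wpM2l //.
      rewrite -!exprM lerD2l exprMn -exprM.
      have := quart_sub_le (dev j q) (dev i q); rewrite /=; lra.
    under eq_bigr do rewrite -mulr_sumr.
    rewrite -mulr_sumr; apply: ler_wpM2l => //.
    have cst (x : R) : \sum_(j < N) x = N%:R * x by rewrite sumr_const card_ord mulr_natl.
    under eq_bigr do rewrite big_split /= -mulr_sumr [X in _ + 288 * X]big_split /= !cst.
    rewrite big_split /= -[X in _ + X <= _]mulr_sumr [X in _ + 288 * X <= _]big_split /=.
    rewrite -[X in _ + _ * (X + _) <= _]mulr_sumr !sum_level // QU_size // !mul1r.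
    by rewrite lerD2l ler_wpM2l // lerD2l sum_dev_quart.
  rewrite -mulr_sumr -[leRHS]mulrA; apply: ler_wpM2l => //.
  have Ac : \sum_(q in QU d) A z q ^+ 4 <= \sum_(q in QU d) c z q ^+ 4.
    apply: le_trans (sum_gmean_quart _) _; rewrite ler_sum // => q _.
    by rewrite !(exprM _ 2 2) real_normK ?num_real.
  have cL := sum_centered_quart zO; rewrite -/(c z) in cL.
  have -> : \sum_(q in QU d) (54 * zeta ^+ 4 + 288 * Delta ^+ 4 + 396 * L z q) =
    2 * (27 * \sum_(q in QU d) (zeta ^+ 4 + 2 * L z q)) +
    288 * \sum_(q in QU d) (L z q + Delta ^+ 4).
    by rewrite !mulr_sumr -big_split /=; apply: eq_bigr => q _; ring.
  have -> : \sum_(q in QU d) (N%:R * (c z q ^+ 4 + A z q ^+ 4) +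
       288 * (N%:R * L z q + N%:R * Delta ^+ 4)) =
    N%:R * (\sum_(q in QU d) c z q ^+ 4 + \sum_(q in QU d) A z q ^+ 4 +
      288 * \sum_(q in QU d) (L z q + Delta ^+ 4)).
    rewrite mulr_sumr -!big_split mulr_sumr /=; apply: eq_bigr => q _; ring.
  apply: ler_wpM2l; first exact: ltW NR_gt0.
  rewrite lerD2r; apply: le_trans (lerD (lexx _) Ac) _.
  by rewrite -[2]/(1 + 1) mulrDl mul1r lerD.
rewrite ExE meanZ mean_sum.
have -> : N%:R * (kappa ^+ 2 * (162 * zeta ^+ 4 + 2052 * Delta ^+ 4) * #|QU d|%:R) =
  3 * kappa ^+ 2 * N%:R * \sum_(q in QU d) (54 * zeta ^+ 4 + 684 * Delta ^+ 4).
  by rewrite sumr_const -[X in _ = _ * X]mulr_natl; ring.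
apply: ler_wpM2l; first by rewrite mulr_ge0.
apply: ler_sum => q qU; rewrite meanD mean_cst // meanZ.
have := Ex_level_quart q; rewrite QU_size // mul1r ExE -/(L _ q).
by rewrite /L; lra.
Qed.

End Unreplicated.
End Variance.

(** * Comparison with the Frobenius norm *)

Section Norms.
Variables (R : realType) (m n : nat).
Implicit Type A : 'M[R]_(m, n).

Definition frob2 A : R := \sum_i \sum_j A i j ^+ 2.

Lemma frob2_ge0 A : 0 <= frob2 A.
Proof. by apply: sumr_ge0 => i _; apply: sumr_ge0 => j _; exact: sqr_ge0. Qed.

Lemma maxnorm_sqr_le A : maxnorm A ^+ 2 <= frob2 A.
Proof.
suff : maxnorm A <= Num.sqrt (frob2 A).
  move=> le; rewrite -[leRHS]sqr_sqrtr ?frob2_ge0 // lerXn2r ?nnegrE ?sqrtr_ge0 //.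
  exact: bigmax_ge_id.
apply: bigmax_le => [|i _]; first exact: sqrtr_ge0.
apply: bigmax_le => [|j _]; first exact: sqrtr_ge0.
rewrite -sqrtr_sqr ler_wsqrtr // /frob2 (bigD1 i) //= (bigD1 j) //= -addrA lerDl.
apply: addr_ge0; first by apply: sumr_ge0 => k _; exact: sqr_ge0.
by apply: sumr_ge0 => k _; apply: sumr_ge0 => l _; exact: sqr_ge0.
Qed.

(** Row by row this is Cauchy-Schwarz: the gap is the squared residual of the row after projection
    on the unit vector [x]. *)
Lemma mulmx_unit_sqr_le A (x : 'cV[R]_n) : \sum_j x j 0 ^+ 2 = 1 ->
  \sum_i (A *m x) i 0 ^+ 2 <= frob2 A.
Proof.
move=> x1; apply: ler_sum => i _; set s := (A *m x) i 0.
rewrite -subr_ge0.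
have -> : \sum_j A i j ^+ 2 - s ^+ 2 = \sum_j (A i j - s * x j 0) ^+ 2.
  have sE : s = \sum_j A i j * x j 0 by rewrite /s mxE.
  transitivity (\sum_j A i j ^+ 2 - 2 * s * (\sum_j A i j * x j 0) + s ^+ 2 * \sum_j x j 0 ^+ 2).
    by rewrite -sE x1; ring.
  by rewrite !mulr_sumr -sumrB -big_split /=; apply: eq_bigr => j _; ring.
by apply: sumr_ge0 => j _; exact: sqr_ge0.
Qed.

Lemma opnorm_sqr_le A : opnorm A ^+ 2 <= frob2 A.
Proof.
rewrite /opnorm; set S := (X in sup X).
have ubS : ubound S (Num.sqrt (frob2 A)).
  by move=> r [x [x1 ->]]; rewrite ler_wsqrtr // mulmx_unit_sqr_le.
(* Without columns there is no unit vector, and the supremum of the empty set is 0. *)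
have [->|/set0P[r Sr]] := eqVneq S classical_sets.set0.
  by rewrite sup0 expr0n frob2_ge0.
rewrite -[leRHS]sqr_sqrtr ?frob2_ge0 // lerXn2r ?nnegrE ?sqrtr_ge0 //.
  apply: (@le_trans _ _ r); last by apply: ub_le_sup => //; exists (Num.sqrt (frob2 A)).
  by case: Sr => x [_ ->]; exact: sqrtr_ge0.
by apply: ge_sup => //; exists r.
Qed.

Lemma le_rows_maxnorm A (S : {set 'I_m}) i j : i \in S -> `|A i j| <= rows_maxnorm A S.
Proof.
move=> iS; apply: (@le_trans _ _ (\big[Num.max/0]_(k < n) `|A i k|)).
  exact: (le_bigmax_cond _ (fun k => `|A i k|)).
exact: (le_bigmax_cond _ (fun k => \big[Num.max/0]_(l < n) `|A k l|)).
Qed.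

Lemma row_products_le A (S : {set 'I_m}) i j k : i \in S ->
  `|A i j * A i k| <= rows_maxnorm A S ^+ 2.
Proof. by move=> iS; rewrite normrM expr2 ler_pM // le_rows_maxnorm. Qed.

End Norms.

(** * From weighted sums to the rates of (ii) and (iii) *)

Section EntryVariance.
Variables (R : realType) (d : design R).
Local Notation N := (nU d).
Local Notation Q := (nQ d).
Local Notation H := (nH d).
Local Notation Nq := (@gsize _ d).
Local Notation F := (Fm d).
Variables (cl cu Delta zeta Cmu : R).
Hypothesis sumN : (\sum_q Nq q)%N = N.
Hypothesis Nq_gt0 : forall q, (1 <= Nq q)%N.
Hypothesis N_gt0 : (0 < N)%N.
Hypothesis cl_gt0 : 0 < cl.
Hypothesis cl_le_cu : cl <= cu.
Hypothesis large : exists N0 : nat, (0 < N0)%N /\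
  forall q, q \in QL d -> cl * N0%:R <= (Nq q)%:R <= cu * N0%:R.
Hypothesis Scov_gt0 : forall q : 'I_Q, 0 < Scov q q :> R.
Hypothesis cond3 : forall q : 'I_Q, N%:R^-1 * \sum_i (Ypo i q - Ybar q) ^+ 4 <= Delta ^+ 4.
Hypothesis cond6 : forall q, q \in QU d -> `|Ybar q - Ybar_grp (group q)| <= zeta.
Hypothesis mu_le : forall q, q \in QU d -> mu_grp (group q) <= Cmu.

(** The outer 2 pays for splitting an entry into unreplicated and replicated sums; [(cu / cl) ^+ 3]
    pays for replacing the sizes of the large levels by their total [NL d]. *)
Definition rate_const : R :=
  2 * (Cmu ^+ 2 * (162 * zeta ^+ 4 + 2052 * Delta ^+ 4)
       + 900 * Delta ^+ 4 * (1 + (cu / cl) ^+ 3)).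

Lemma quart_ge0 (x : R) : 0 <= x ^+ 4.
Proof. by rewrite (exprM x 2 2) sqr_ge0. Qed.

Lemma rate_const_ge0 : 0 <= rate_const.
Proof.
have r0 : 0 <= (cu / cl) ^+ 3.
  by rewrite exprn_ge0 // divr_ge0 ?(ltW cl_gt0) // (le_trans _ cl_le_cu) ?ltW.
have := quart_ge0 zeta; have := quart_ge0 Delta => D0 z0.
apply: mulr_ge0 (ler0n _ _) _; apply: addr_ge0; last first.
  exact: mulr_ge0 (mulr_ge0 (ler0n _ _) D0) (addr_ge0 ler01 r0).
by rewrite mulr_ge0 ?sqr_ge0 // addr_ge0 // mulr_ge0.
Qed.

Lemma rateE p : rate d p = rate d 0 * H%:R ^+ p.
Proof. by rewrite /rate !expr0; ring. Qed.

Lemma rate0_ge0 : 0 <= rate d 0.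
Proof.
rewrite /rate expr0 !mulr1; apply: addr_ge0.
  by apply: addr_ge0; rewrite mulr_ge0 ?quart_ge0.
by rewrite divr_ge0 ?exprn_ge0 // mulr_ge0 ?quart_ge0 ?exprn_ge0.
Qed.

Lemma mu_grp_ge0 (q : 'I_Q) : 0 <= mu_grp (group q) :> R.
Proof.
have N2 : 2 <= N%:R :> R by rewrite ler_nat (Scov_gt0_size (Scov_gt0 q)).
rewrite mulr_ge0 ?invr_ge0 ?sqr_ge0 // subr_ge0 ler_pdivrMr ?mul1r //.
by rewrite ltr0n.
Qed.

(* On the large levels [N_q >= cl N_0], while [N_L <= cu N_0 |Q_L|]. *)
Lemma replicated_weights (w : 'I_Q -> R) :
  (forall S : {set 'I_Q}, forall q, q \in S -> `|w q| <= rows_maxnorm F S ^+ 2) ->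
  \sum_(q | q \notin QU d) w q ^+ 2 / (Nq q)%:R ^+ 3 <=
  rows_maxnorm F (QR d) ^+ 4 * #|QR d|%:R +
  (cu / cl) ^+ 3 * (rows_maxnorm F (QL d) ^+ 4 * #|QL d|%:R ^+ 4 / (NL d)%:R ^+ 3).
Proof.
move=> wS; have [N0 [N0p NL0]] := large.
have N0R : 0 < N0%:R :> R by rewrite ltr0n.
have cu0 : 0 < cu by exact: lt_le_trans cl_le_cu.
set FR := rows_maxnorm F (QR d); set FL := rows_maxnorm F (QL d).
have w4 (S : {set 'I_Q}) q : q \in S -> w q ^+ 2 <= rows_maxnorm F S ^+ 4.
  move=> qS; rewrite -real_normK ?num_real // (exprM _ 2 2) lerXn2r ?nnegrE ?sqr_ge0 //.
  exact: wS.
pose bL := FL ^+ 4 / (cl * N0%:R) ^+ 3.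
have bL0 : 0 <= bL.
  by rewrite divr_ge0 ?quart_ge0 // exprn_ge0 // mulr_ge0 // ltW.
apply: (@le_trans _ _ (FR ^+ 4 * #|QR d|%:R + bL * #|QL d|%:R)).
  have -> : FR ^+ 4 * #|QR d|%:R + bL * #|QL d|%:R =
     \sum_q ((if q \in QR d then FR ^+ 4 else 0) + (if q \in QL d then bL else 0)).
    by rewrite big_split /= -!big_mkcond /= !sumr_const !mulr_natr.
  rewrite big_mkcond; apply: ler_sum => q _.
  case: ifP => [qU|_]; last by rewrite addr_ge0 //; case: ifP => // _; exact: quart_ge0.
  have n2 : (2 <= Nq q)%N by exact: notin_QU.
  have nR : 1 <= (Nq q)%:R :> R by rewrite ler1n.
  have n0 : 0 < (Nq q)%:R :> R by rewrite ltr0n.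
  (* Outside [QU d], a level is either large or, having at least two units, in [QR d]. *)
  have [qL|qL] := boolP (q \in QL d).
    apply: (@le_trans _ _ bL); last by rewrite lerDr; case: ifP => // _; exact: quart_ge0.
    rewrite /bL ler_pM ?sqr_ge0 ?invr_ge0 ?exprn_ge0 ?w4 ?(ltW n0) //.
    rewrite lef_pV2 ?posrE ?exprn_gt0 ?mulr_gt0 // lerXn2r ?nnegrE ?(ltW n0) ?mulr_ge0 ?(ltW cl_gt0) //.
    by have /andP[] := NL0 q qL.
  have qR : q \in QR d by rewrite !inE n2 andbT.
  rewrite qR addr0 ler_pdivrMr ?exprn_gt0 //.
  apply: le_trans (w4 _ _ qR) _; rewrite ler_peMr ?quart_ge0 //.
  by rewrite exprn_ege1.
rewrite lerD2l.
have [L0|Lp] := posnP #|QL d|.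
  rewrite L0 mulr0 mulr_ge0 ?exprn_ge0 // divr_ge0 ?(ltW cu0) ?(ltW cl_gt0) //.
    by rewrite mulr_ge0 ?quart_ge0 ?exprn_ge0.
  by rewrite exprn_ge0.
have [q0 q0L] : exists q, q \in QL d by apply/card_gt0P.
have NLp : 0 < (NL d)%:R :> R.
  by rewrite ltr0n /NL (bigD1 q0) //= addn_gt0 Nq_gt0.
have NLle : (NL d)%:R <= #|QL d|%:R * (cu * N0%:R) :> R.
  rewrite /NL natr_sum mulr_natl -sumr_const; apply: ler_sum => q qL.
  by have /andP[] := NL0 q qL.
have -> : (cu / cl) ^+ 3 * (FL ^+ 4 * #|QL d|%:R ^+ 4 / (NL d)%:R ^+ 3) =
   bL * #|QL d|%:R * ((#|QL d|%:R * (cu * N0%:R)) ^+ 3 / (NL d)%:R ^+ 3).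
  by rewrite /bL; field; rewrite !gt_eqF.
apply: ler_peMr; first by rewrite mulr_ge0.
by rewrite ler_pdivlMr ?exprn_gt0 // mul1r lerXn2r ?nnegrE ?(ltW NLp) // (le_trans (ltW NLp)).
Qed.

Lemma entry_variance h h' :
  Ex (fun z => (Vgamma_hat z h h' - EVgamma_hat d h h') ^+ 2) <= rate_const * rate d 0.
Proof.
pose w q := F q h * F q h'.
have wS (S : {set 'I_Q}) q : q \in S -> `|w q| <= rows_maxnorm F S ^+ 2.
  exact: row_products_le.
pose fU z := \sum_(q in QU d)
  (w q * mu_grp (group q)) * (Yhat z q - Yhat_grp z (group q)) ^+ 2.
pose fS z := \sum_(q | q \notin QU d) w q * ((Nq q)%:R^-1 * Shat z q).
have Vf z : Vgamma_hat z h h' = fU z + fS z.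
  rewrite Vgamma_hatE (bigID (mem (QU d))) /=; congr (_ + _); apply: eq_bigr => q qU.
    by rewrite /vhat qU -/(w q); ring.
  by rewrite /vhat (negbTE qU) mulrC.
have Ef : EVgamma_hat d h h' = Ex fU + Ex fS.
  by rewrite mxE !ExE -meanD; apply: eq_mean => z _; exact: Vf.
apply: (@le_trans _ _ (2 * Ex (fun z => (fU z - Ex fU) ^+ 2) + 2 * Ex (fun z => (fS z - Ex fS) ^+ 2))).
  rewrite !(ExE (fun z => _ ^+ 2)) -!meanZ -meanD; apply: le_mean => z _; rewrite Vf Ef.
  move: (Ex fU) (Ex fS) (fU z) (fS z) => a b x y.
  have := sqr_ge0 ((x - a) - (y - b)); lra.
set u := rows_maxnorm F (QU d).
(* The absolute value covers an empty [QU d], for which the sign of [Cmu] is unconstrained. *)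
have VU : Ex (fun z => (fU z - Ex fU) ^+ 2) <=
   (u ^+ 2 * `|Cmu|) ^+ 2 * (162 * zeta ^+ 4 + 2052 * Delta ^+ 4) * #|QU d|%:R.
  apply: unreplicated_variance => //; first by rewrite mulr_ge0 ?sqr_ge0.
  move=> q qU; rewrite normrM ler_pM // ?wS // ger0_norm ?mu_grp_ge0 //.
  exact: le_trans (mu_le qU) (ler_norm _).
have VS := replicated_variance sumN Nq_gt0 N_gt0 cond3 w; rewrite -/fS in VS.
have D0 := quart_ge0 Delta; have z0 := quart_ge0 zeta.
have {}VS := le_trans VS (ler_wpM2l (mulr_ge0 (ler0n R 900) D0) (replicated_weights wS)).
apply: le_trans (lerD (ler_wpM2l (ler0n R 2) VU) (ler_wpM2l (ler0n R 2) VS)) _.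
have -> : (u ^+ 2 * `|Cmu|) ^+ 2 = Cmu ^+ 2 * u ^+ 4.
  by rewrite exprMn real_normK ?num_real // -exprM mulrC.
rewrite /rate expr0 !mulr1 -/u /rate_const.
set a := u ^+ 4 * _; set b := _ * #|QR d|%:R; set c := _ / (NL d)%:R ^+ 3.
have a0 : 0 <= a by rewrite mulr_ge0 ?quart_ge0.
have b0 : 0 <= b by rewrite mulr_ge0 ?quart_ge0.
have c0 : 0 <= c by rewrite divr_ge0 ?exprn_ge0 // mulr_ge0 ?quart_ge0 ?exprn_ge0.
have r0 : 0 <= (cu / cl) ^+ 3.
  by rewrite exprn_ge0 // divr_ge0 ?(ltW cl_gt0) // (le_trans _ cl_le_cu) ?ltW.
set k0 := 162 * _ + _; set k2 := 900 * _; set r := (cu / cl) ^+ 3 in r0 *.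
have k00 : 0 <= k0 by rewrite addr_ge0 // mulr_ge0.
have k20 : 0 <= k2 by rewrite mulr_ge0.
have k10 : 0 <= Cmu ^+ 2 * k0 by rewrite mulr_ge0 ?sqr_ge0.
have -> : Cmu ^+ 2 * u ^+ 4 * k0 * #|QU d|%:R = Cmu ^+ 2 * k0 * a.
  by rewrite /a; clearbody k0; ring.
move: (Cmu ^+ 2 * k0) k10 => k1 k10.
clearbody a b c k2 r; rewrite -mulrDr -[leRHS]mulrA ler_wpM2l ?ler0n // -subr_ge0.
have -> : (k1 + k2 * (1 + r)) * (a + b + c) - (k1 * a + k2 * (b + r * c)) =
   k1 * (b + c) + (k2 * (a + c) + k2 * r * (a + b)) by ring.
apply: addr_ge0 (mulr_ge0 k10 (addr_ge0 b0 c0)) _.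
exact: addr_ge0 (mulr_ge0 k20 (addr_ge0 a0 c0)) (mulr_ge0 (mulr_ge0 k20 r0) (addr_ge0 a0 b0)).
Qed.

Lemma Ex_frob2_le :
  Ex (fun z => frob2 (Vgamma_hat z - EVgamma_hat d)) <= rate_const * rate d 2.
Proof.
rewrite ExE mean_sum.
apply: (@le_trans _ _ (\sum_(h < H) \sum_(h' < H) rate_const * rate d 0)).
  apply: ler_sum => h _; rewrite mean_sum; apply: ler_sum => h' _.
  apply: le_trans (entry_variance h h'); rewrite ExE; apply: le_mean => z _.
  by rewrite !mxE.
have cst (x : R) : \sum_(j < H) x = x * H%:R by rewrite sumr_const card_ord mulr_natr.
by rewrite !cst (rateE 2) expr2 !mulrA.
Qed.

(** Since [H] is a natural number, [H ^+ 2 <= H ^+ 4], also for [H = 0]. The Frobenius bound for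
    (ii) thus yields (iii) as well. *)
Lemma rate2_le_rate4 : rate d 2 <= rate d 4.
Proof.
rewrite (rateE 2) (rateE 4) ler_wpM2l ?rate0_ge0 // -!natrX ler_nat.
by case: H => // n; rewrite leq_pexp2l.
Qed.

End EntryVariance.

(** * Markov's inequality and conclusion *)

(** Markov's inequality at the threshold [(C + 1) / eps * r]; the added 1 keeps the multiplier
    positive when [C = 0]. *)
Lemma markov_rate (R : realType) (d : design R) (X : assign d -> R) (r C eps : R) :
  (forall z, 0 <= X z) -> 0 <= C -> 0 <= r -> 0 < eps -> Ex X <= C * r ->
  Pr (fun z => (C + 1) / eps * r < `|X z|) <= eps.
Proof.
move=> X0 C0 r0 e0 XC; set M := (C + 1) / eps.
have M0 : 0 < M by rewrite divr_gt0 // ltr_wpDl.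
set A := finset (fun z => (z \in Omega d) && (M * r < `|X z|)).
have PrA : Pr (fun z => M * r < `|X z|) = #|Omega d|%:R^-1 * #|A|%:R.
  by rewrite /Pr mulrC.
rewrite PrA; have [->|/set0Pn[z0 z0A]] := eqVneq A finset.set0.
  by rewrite cards0 mulr0 ltW.
have {z0 z0A} [z0 z0O z0X] : exists2 z, z \in Omega d & M * r < X z.
  by exists z0; move: z0A; rewrite finset.in_set => /andP[] //; rewrite ger0_norm.
have Op : 0 < #|Omega d|%:R^-1 :> R.
  by rewrite invr_gt0 ltr0n; apply/card_gt0P; exists z0.
have sumX : \sum_(z in A) X z <= \sum_(z in Omega d) X z.
  rewrite [leRHS](bigID (fun z => M * r < `|X z|)) /=.
  rewrite (eq_bigl (fun z => (z \in Omega d) && (M * r < `|X z|))) ?lerDl ?sumr_ge0 // => z.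
  by rewrite finset.in_set.
(* If [r = 0], then the nonnegative [X] has mean zero, so it vanishes on [Omega d] and the event is
   empty. *)
have rp : 0 < r.
  rewrite lt_neqAle r0 andbT; apply/eqP => r00; move: XC z0X; rewrite -r00 !mulr0.
  rewrite /Ex pmulr_rle0 // leNgt => /negP XC z0X; apply: XC.
  by rewrite (bigD1 z0) //= ltr_pwDl // sumr_ge0.
have : M * r * (#|Omega d|%:R^-1 * #|A|%:R) <= C * r.
  apply: le_trans XC; rewrite mulrCA /Ex ler_pM2l // (le_trans _ sumX) //.
  rewrite mulr_natr -sumr_const; apply: ler_sum => z; rewrite finset.in_set => /andP[_].
  by rewrite ger0_norm // => /ltW.
move=> H; rewrite -(ler_pM2l (mulr_gt0 M0 rp)); apply: le_trans H _.
have -> : M * r * eps = (C + 1) * r by rewrite /M; field; rewrite gt_eqF.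
by rewrite ler_wpM2r // lerDl.
Qed.

Lemma Ex_le (R : realType) (d : design R) (X X' : assign d -> R) :
  (forall z, X z <= X' z) -> Ex X <= Ex X'.
Proof. by move=> leX; rewrite !ExE; apply: le_mean => z _. Qed.

Theorem theorem9 (R : realType) (D : nat -> design R)
  (nbar : nat) (cl cu Delta zeta Cmu : R) :
  (* the sequence is indexed by N -> infinity *)
  (forall M : nat, exists k0 : nat, forall k, (k0 <= k)%N -> (M <= nU (D k))%N) ->
  (* complete randomization design: group sizes N_q >= 1 summing to N *)
  (forall k, (\sum_(q < nQ (D k)) gsize q)%N = nU (D k)) ->
  (forall k (q : 'I_(nQ (D k))), (1 <= gsize q)%N) ->
  (* non-uniform design with fixed constants nbar, cl, cu *)
  0 < cl -> cl <= cu ->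
  (forall k (q : 'I_(nQ (D k))), q \in QS (D k) -> (gsize q <= nbar)%N) ->
  (forall k, exists N0 : nat, (0 < N0)%N /\
     forall q : 'I_(nQ (D k)), q \in QL (D k) ->
       cl * N0%:R <= (gsize q)%:R <= cu * N0%:R) ->
  (* the grouping of Q_U: groups of size >= 2 *)
  (forall k (q : 'I_(nQ (D k))), q \in QU (D k) -> (2 <= #|group q|)%N) ->
  (* S(q,q) > 0 *)
  (forall k (q : 'I_(nQ (D k))), 0 < Scov q q :> R) ->
  (* Condition 3 with Delta bounded by a constant *)
  (forall k (q : 'I_(nQ (D k))),
     (nU (D k))%:R^-1 * \sum_i (Ypo i q - Ybar q) ^+ 4 <= Delta ^+ 4) ->
  (* Condition 5 *)
  (forall k (q : 'I_(nQ (D k))), q \in QU (D k) ->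
     0 <= (nU (D k))%:R - rho_grp (group q) - (#|group q|%:R - 1)) ->
  (* Condition 6 with zeta bounded by a constant *)
  (forall k (q : 'I_(nQ (D k))), q \in QU (D k) -> `|Ybar q - Ybar_grp (group q)| <= zeta) ->
  (* max_g mu_<g> bounded by a constant *)
  (forall k (q : 'I_(nQ (D k))), q \in QU (D k) -> mu_grp (group q) <= Cmu) ->
  (* (i) *)
  (forall k, loewner_ge (EVgamma_hat (D k)) (Vgamma (D k))) /\
  (* (ii) *)
  bigOP D (fun k z => maxnorm (Vgamma_hat z - EVgamma_hat (D k)) ^+ 2)
          (fun k => rate (D k) 2) /\
  (* (iii) *)
  bigOP D (fun k z => opnorm (Vgamma_hat z - EVgamma_hat (D k)) ^+ 2)
          (fun k => rate (D k) 4).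
Proof.
move=> Ninf sumN Nq1 cl0 clcu _ large grp2 S0 c3 c5 c6 muC.
split.
  move=> k.
  exact: (EVgamma_hat_conservative (sumN k) (Nq1 k) (grp2 k) (S0 k) (c5 k)).
(* From [k0] on there is at least one unit, as the variance bounds require. *)
have [k0 k0P] := Ninf 1%N; pose C := rate_const cl cu Delta zeta Cmu.
have C0 : 0 <= C by exact: rate_const_ge0.
have frob k : (k0 <= k)%N ->
    Ex (fun z => frob2 (Vgamma_hat z - EVgamma_hat (D k))) <= C * rate (D k) 2.
  move=> /k0P N1.
  exact: (Ex_frob2_le (sumN k) (Nq1 k) N1 cl0 clcu (large k) (S0 k) (c3 k) (c6 k) (muC k)).
have rate_ge0 k p : 0 <= rate (D k) p.
  by rewrite rateE mulr_ge0 ?exprn_ge0 ?rate0_ge0.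
by split=> eps eps0; exists ((C + 1) / eps); (split; first by rewrite divr_gt0 // ltr_wpDl);
  exists k0 => k kk; apply: markov_rate => //;
  [move=> z; exact: sqr_ge0 | apply: le_trans (frob k kk); apply: Ex_le => z;
     exact: maxnorm_sqr_le
  |move=> z; exact: sqr_ge0 | apply: le_trans (ler_wpM2l C0 (rate2_le_rate4 (D k)));
     apply: le_trans (frob k kk); apply: Ex_le => z; exact: opnorm_sqr_le].
Qed.
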